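(* Let $B_k(t,\alpha)$, $\alpha\in\mathbb Z^m\cap kP$, $t\in[0,1]$, $k\ge1$, be a family of complex-valued lattice point functions satisfying $|B_k(t,\alpha)|\le C_0k^{N}$ for some $C_0,N\ge0$. Then there exists $C>0$ so that for any $\delta>0$, $$\sum_{\alpha\in kP\cap\mathbb Z^m}B_k(t,\alpha)\frac{|s_\alpha(z)|^2_{h_t^k}}{\mathcal Q_{h_t^k}(\alpha)}=\sum_{\alpha\in kP\cap\mathbb Z^m:\ |\frac{\alpha}{k}-\mu_t(z)|\le k^{-\frac12+\delta}}B_k(t,\alpha)\frac{|s_\alpha(z)|^2_{h_t^k}}{\mathcal Q_{h_t^k}(\alpha)}+O_\delta(k^{-C}),$$ for $z\in M$, $t\in[0,1]$.
   Context: $M$ is a smooth compact toric variety of complex dimension $m$, $L\to M$ a very ample toric (equivariant) line bundle with Delzant lattice polytope $P\subset\mathbb R^m$ (closed). On the open orbit $M^o\cong(\mathbb C^* )^m$ write $z=e^{\rho/2+i\theta}$; $\mathbf T^m$ is the real torus. Let $e$ be the frame of $L$ over $M^o$ such that for every $k\ge1$ the sections $s_\alpha=z^\alpha e^{\otimes k}$, $\alpha\in kP\cap\mathbb Z^m$, extend to $M$ and form a basis of $H^0(M,L^k)$. A toric Hermitian metric $h$ on $L$ is a smooth $\mathbf T^m$-invariant one with positive curvature form $\omega_h=-\frac{i}{2\pi}\partial\bar\partial\log|e|_h^2$. Write $|e|^2_h=e^{-\psi_h(\rho)}$ on $M^o$; the moment map $\mu_h=\nabla_\rho\psi_h$ extends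 to a smooth map $\mu_h:M\to P$; the symplectic potential is $u_h(x)=\sup_\rho(\langle x,\rho\rangle-\psi_h(\rho))$ on $P$. $h^k$ is the induced metric on $L^k$, $dV_h=\omega_h^m/m!$, and $\mathcal Q_{h^k}(\alpha)=\int_M|s_\alpha|^2_{h^k}\,dV_h$. Toric metrics $h_0,h_1$ are fixed, and $h_t$ ($0\le t\le1$) is the Monge–Ampère (Mabuchi) geodesic between them, i.e. the smooth path of toric metrics with $u_{h_t}=(1-t)u_{h_0}+tu_{h_1}$; $\mu_t=\mu_{h_t}$. The implied constant in $O_\delta$ depends on $\delta$ (and on the fixed data) but not on $k$. *)

(* Defs.v *)
From HB Require Import structures.
From mathcomp Require Export all_boot all_order all_algebra.
From mathcomp Require Export complex.
From mathcomp Require Export all_classical all_reals all_analysis.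
Export Order.TTheory GRing.Theory Num.Theory.
Export numFieldNormedType.Exports.
Export Normc.

Set Implicit Arguments.
Unset Strict Implicit.
Unset Printing Implicit Defensive.

Local Open Scope classical_set_scope.
Local Open Scope complex_scope.
Local Open Scope ring_scope.

Definition dotrv (R : realType) n (x y : 'rV[R]_n) : R :=
  \sum_j x 0 j * y 0 j.

(* The canonical norm `|x| on 'rV[R]_n is the sup norm. *)
Definition enorm (R : realType) n (x : 'rV[R]_n) : R := Num.sqrt (dotrv x x).

Fixpoint Cn (R : realType) n (N : nat) (f : 'rV[R]_n -> R) : Prop :=
  continuous f /\
  if N is N'.+1 then
    forall j : 'I_n, (forall x, derivable f x (delta_mx 0 j)) /\
                     Cn N' (fun x => 'D_(delta_mx 0 j) f x)
  else True.

Definition smooth (R : realType) n (f : 'rV[R]_n -> R) : Prop :=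
  forall N, Cn N f.

(* Lebesgue integral over R^n of a nonnegative function, as an iterated
   integral (Tonelli). *)
Fixpoint integral_rV (R : realType) (n : nat) : ('rV[R]_n -> \bar R) -> \bar R :=
  if n is n'.+1 return ('rV[R]_n -> \bar R) -> \bar R then
    fun f => (\int[lebesgue_measure]_x
                integral_rV (fun y : 'rV[R]_n' =>
                               f (row_mx (const_mx x : 'rV[R]_1) y)))%E
  else fun f => f 0.

Definition intrv (R : realType) m n (a : 'M[int]_(m, n)) : 'M[R]_(m, n) :=
  map_mx intr a.

Definition conv_rV (R : realType) m n (v : 'I_n -> 'rV[R]_m) : set 'rV[R]_m :=
  [set x | exists c : 'I_n -> R,
     [/\ forall i, 0 <= c i, \sum_i c i = 1 & x = \sum_i c i *: v i]].

(* The rows of [edge i] are the primitive edge vectors at the vertex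
   [vert i]: they form a Z-basis of Z^m and generate the tangent cone of the
   polytope there.  Every [vert i] is then a vertex, and the polytope has
   dimension m. *)
Record delzant (R : realType) (m : nat) := Delzant {
  nvert : nat;
  vert : 'I_nvert.+1 -> 'rV[int]_m;
  edge : 'I_nvert.+1 -> 'M[int]_m;
  vert_inj : injective vert;
  edge_unit : forall i, edge i \in unitmx;
  edge_cone : forall i (x : 'rV[R]_m),
    (exists2 s : R, 0 < s &
       conv_rV (fun l => intrv R (vert l)) (intrv R (vert i) + s *: x)) <->
    (exists2 c : 'rV[R]_m, forall j, 0 <= c 0 j & x = c *m intrv R (edge i))
}.

Arguments vert {R m} d i.
Arguments edge {R m} d i.

Definition polytope (R : realType) m (P : delzant R m) : set 'rV[R]_m :=
  conv_rV (fun i => intrv R (vert P i)).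

Definition lattice_points (R : realType) m (P : delzant R m) (k : nat) :
    set 'rV[int]_m :=
  [set a | exists2 x, polytope P x & intrv R a = k%:R *: x].

(* The polarized toric variety (M, L) of a Delzant lattice polytope.

    M is glued from one chart C^m per vertex v_i; the coordinates of the i-th
    chart are w_j = z^(E_ij) on M^o = (C^* )^m, where E_ij is the j-th row of
    [edge i].  A point of M is given by a pair (i, w), up to [glued].
    L is trivialized over the i-th chart by the section e_i = z^(v_i) e, where
    e is the frame over M^o.  By Demazure, every ample toric line bundle on a
    smooth compact toric variety is very ample, so that every pair (M, L) with
    L very ample arises in this way, and conversely. *)

Section ToricVariety.
Variables (R : realType) (m : nat) (P : delzant R m).

Definition chart := 'I_(nvert P).+1.

Definition monomial (w : 'rV[R[i]]_m) (a : 'rV[int]_m) : R[i] :=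
  \prod_j w 0 j ^ a 0 j.

(* The exponent of w in s_a = z^a e^k = w^(chart_exp k i a) e_i^k; it is
   nonnegative for a in kP. *)
Definition chart_exp (k : nat) (i : chart) (a : 'rV[int]_m) : 'rV[int]_m :=
  (a - vert P i *+ k) *m invmx (edge P i).

(* Chart i' meets chart i where the section e_i' does not vanish; since
   E_i' = (E_i' E_i^-1) E_i, the change of coordinates is monomial.  Its
   negative exponents only occur at coordinates that do not vanish. *)
Definition glued (i : chart) (w : 'rV[R[i]]_m) (i' : chart) (w' : 'rV[R[i]]_m) :=
  (forall j, 0 < chart_exp 1 i (vert P i') 0 j -> w 0 j != 0) /\
  (forall j, w' 0 j = monomial w (row j (edge P i' *m invmx (edge P i)))).

(* z = e^(rho / 2 + i theta) *)
Definition expz (rho theta : 'rV[R]_m) : 'rV[R[i]]_m :=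
  \row_j ((expR (rho 0 j / 2))%:C * (cos (theta 0 j) +i* sin (theta 0 j))).

Definition orbit_coord (i : chart) (z : 'rV[R[i]]_m) : 'rV[R[i]]_m :=
  \row_j monomial z (row j (edge P i)).

Definition torus_act (theta : 'rV[R]_m) (i : chart) (w : 'rV[R[i]]_m) :
    'rV[R[i]]_m :=
  \row_j (orbit_coord i (expz 0 theta) 0 j * w 0 j).

(* R^2m -> C^m, (x, y) |-> x + i y *)
Definition toC (p : 'rV[R]_(m + m)) : 'rV[R[i]]_m :=
  \row_j (p 0 (lshift m j) +i* p 0 (rshift m j)).

(* h i w is |e_i|^2_h at the point (i, w). *)
Definition metric := chart -> 'rV[R[i]]_m -> R.

(* The complex Hessian (d^2 phi / dw_j d\bar w_l)_(j, l), where
   d/dw = (d/dx - i d/dy) / 2 and d/d\bar w = (d/dx + i d/dy) / 2. *)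
Definition complex_hessian (phi : 'rV[R]_(m + m) -> R) (p : 'rV[R]_(m + m)) :
    'M[R[i]]_m :=
  let D2 (a b : 'I_(m + m)) :=
    'D_(delta_mx 0 a) (fun q => 'D_(delta_mx 0 b) phi q) p in
  \matrix_(j, l)
    (((D2 (lshift m j) (lshift m l) + D2 (rshift m j) (rshift m l)) / 4) +i*
     ((D2 (lshift m j) (rshift m l) - D2 (rshift m j) (lshift m l)) / 4)).

(* The matrix g such that omega_h = (i / 2 pi) sum_jl g_jl dw_j /\ d\bar w_l. *)
Definition curvature (h : metric) (i : chart) (p : 'rV[R]_(m + m)) : 'M[R[i]]_m :=
  complex_hessian (fun q => - ln (h i (toC q))) p.

Record toric_metric (h : metric) : Prop := ToricMetric {
  metric_smooth : forall i, smooth (fun p => h i (toC p));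
  metric_gt0 : forall i w, 0 < h i w;
  (* e_i' = w^(chart_exp 1 i v_i') e_i *)
  metric_glued : forall i w i' w', glued i w i' w' ->
    h i' w' = normc (monomial w (chart_exp 1 i (vert P i'))) ^+ 2 * h i w;
  metric_inv : forall theta i w, h i (torus_act theta i w) = h i w;
  metric_pos : forall i p (c : 'rV[R[i]]_m), c != 0 ->
    0 < \sum_j \sum_l curvature h i p j l * c 0 j * (c 0 l)^*
}.

(* Since i dw /\ d\bar w = 2 dx /\ dy, omega_h^m / m! has density
   pi^-m det g with respect to the Lebesgue measure of the chart. *)
Definition volume_density (h : metric) (i : chart) (p : 'rV[R]_(m + m)) : R :=
  complex.Re (\det (curvature h i p)) / pi ^+ m.

(* |s_a|^2_(h^k) at the point (i, w) *)
Definition sec_norm2 (h : metric) (k : nat) (a : 'rV[int]_m)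
    (i : chart) (w : 'rV[R[i]]_m) : R :=
  normc (monomial w (chart_exp k i a)) ^+ 2 * h i w ^+ k.

(* Q_(h^k)(a).  The complement of any single chart is a null set, so
   integrating over M amounts to integrating over the chart ord0. *)
Definition Qnorm (h : metric) (k : nat) (a : 'rV[int]_m) : R :=
  fine (integral_rV (fun p : 'rV[R]_(m + m) =>
    (sec_norm2 h k a ord0 (toC p) * volume_density h ord0 p)%:E)).

(* psi_h = - log |e|^2_h at z = e^(rho / 2), where e = z^(- v_0) e_0; for a
   toric metric the choices of the chart ord0 and of theta = 0 are
   irrelevant. *)
Definition open_potential (h : metric) (rho : 'rV[R]_m) : R :=
  dotrv (intrv R (vert P ord0)) rho - ln (h ord0 (orbit_coord ord0 (expz rho 0))).

Definition symplectic_potential (h : metric) (x : 'rV[R]_m) : R :=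
  sup (range (fun rho : 'rV[R]_m => dotrv x rho - open_potential h rho)).

(* The continuous extension to M of the gradient of psi_h; it is unique, as
   M^o is dense in M. *)
Definition is_moment_map (h : metric) (mu : chart -> 'rV[R[i]]_m -> 'rV[R]_m) :=
  (forall i, continuous (fun p => mu i (toC p))) /\
  (forall i rho theta, mu i (orbit_coord i (expz rho theta)) =
     \row_j 'D_(delta_mx 0 j) (open_potential h) rho).

(* Joint smoothness on [0, 1] x M is existence of a smooth extension to R x C^m in
   each chart. *)
Definition smooth_path (h : R -> metric) : Prop :=
  forall i, exists2 F : 'rV[R]_(1 + (m + m)) -> R, smooth F &
    forall t p, 0 <= t <= 1 ->
      F (row_mx (const_mx t : 'rV[R]_1) p) = h t i (toC p).

Record mabuchi_geodesic (h0 h1 : metric) (h : R -> metric) : Prop :=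
  MabuchiGeodesic {
    geodesic_toric : forall t, 0 <= t <= 1 -> toric_metric (h t);
    geodesic_smooth : smooth_path h;
    geodesic_0 : h 0 = h0;
    geodesic_1 : h 1 = h1;
    geodesic_potential : forall t x, 0 <= t <= 1 -> polytope P x ->
      symplectic_potential (h t) x =
      (1 - t) * symplectic_potential h0 x + t * symplectic_potential h1 x
  }.

End ToricVariety.

(* Main.v *)
(** Write psi = psi_(h_t) for the open-orbit potential, x = alpha / k and
    y = mu_t(z) = grad psi(rho).  On the open orbit |s_alpha|^2 is
    exp(<alpha, rho> - k psi(rho)).

    In the log coordinates of a chart the Hessian of psi is bounded where the
    chart coordinates are bounded, and every rho has a chart in which they are
    at most 1; hence Hess psi <= C uniformly in rho and t.  The gradient step
    rho' = rho + (x - y) / (2 C) then multiplies |s_alpha|^2 by at least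
    exp(k |x - y|^2 / (4 C)), and it remains to see that the pointwise norm at
    an arbitrary rho' is at most a power of k times Q(alpha).

    For this, choose a chart in which the coordinates of rho' are at most 1 and
    move their moduli outwards by a quantity of order 1 / k.  The monomial
    representing s_alpha does not decrease, as its exponents are nonnegative,
    and h^k changes by a bounded factor.  The moduli are now at least 1 / k, so
    that the volume density of the open orbit in log coordinates is at least
    c k^(-2 m), and all this persists on a box of side of order 1 / k.

    The terms away from y are thus exponentially small in k^(2 delta), against
    polynomially many lattice points. *)
From mathcomp Require Import ring lra zify finmap polyrcf measurable_realfun.
Require Import Defs.
Set Implicit Arguments.
Unset Strict Implicit.
Unset Printing Implicit Defensive.
Local Open Scope classical_set_scope.
Local Open Scope complex_scope.
Local Open Scope ring_scope.

(** The decay rate comes from an upper bound of Hess psi, that is, from uniform strong convexity of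
    the symplectic potentials. The lower bound of Q may lose any power of k, because exp(- kappa
    k^(2 delta)) absorbs it; this is what allows so crude a box. The obstacle is uniformity near the
    boundary divisors, where logarithmic coordinates run off to infinity and det Hess psi tends to
    0. Quantities on the open orbit are therefore factored into explicit powers of the moduli and
    quantities smooth in the chart coordinates w, and only the latter are bounded, by compactness of
    [0, 1] times a box. Q is integrated in one fixed chart, whereas the convenient chart depends on
    the point; unimodularity of the edge matrices moves determinants between the two. The final
    inequality passes from the open orbit to M by continuity. *)

Lemma for_continuous_comp (S T U : topologicalType) (f : S -> T) (g : T -> U) (x : S) :
  continuous_at x f -> continuous_at (f x) g -> continuous_at x (fun x => g (f x)).
Proof. by move=> cf cg; exact: (@continuous_comp _ _ _ f g x cf cg). Qed.

Section Continuity.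
Variables (R : realType) (T : topologicalType).
Implicit Types (f g : T -> R) (x : T).

Lemma for_continuousD f g x : continuous_at x f -> continuous_at x g ->
  continuous_at x (fun x => f x + g x).
Proof. by move=> cf cg; exact: cvgD. Qed.

Lemma for_continuousN f x : continuous_at x f -> continuous_at x (fun x => - f x).
Proof. by move=> cf; exact: cvgN. Qed.

Lemma for_continuousM f g x : continuous_at x f -> continuous_at x g ->
  continuous_at x (fun x => f x * g x).
Proof. by move=> cf cg; exact: cvgM. Qed.

Lemma for_continuousV f x : f x != 0 -> continuous_at x f ->
  continuous_at x (fun x => (f x)^-1).
Proof. by move=> f0 cf; exact: cvgV. Qed.

Lemma for_continuousX f k x : continuous_at x f ->
  continuous_at x (fun x => f x ^+ k).
Proof.
move=> cf; elim: k => [|k IH]; first exact: cst_continuous.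
by under eq_fun do rewrite exprS; exact: for_continuousM.
Qed.

Lemma for_continuous_sum (I : Type) (r : seq I) (P : pred I) (F : I -> T -> R) x :
  (forall i, P i -> continuous_at x (F i)) ->
  continuous_at x (fun x => \sum_(i <- r | P i) F i x).
Proof.
move=> cF; elim: r => [|i r IH].
  by under eq_fun do rewrite big_nil; exact: cst_continuous.
under eq_fun do rewrite big_cons.
by case: ifP => Pi //; apply: for_continuousD => //; exact: cF.
Qed.

Lemma for_continuous_prod (I : Type) (r : seq I) (P : pred I) (F : I -> T -> R) x :
  (forall i, P i -> continuous_at x (F i)) ->
  continuous_at x (fun x => \prod_(i <- r | P i) F i x).
Proof.
move=> cF; elim: r => [|i r IH].
  by under eq_fun do rewrite big_nil; exact: cst_continuous.
under eq_fun do rewrite big_cons.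
by case: ifP => Pi //; apply: for_continuousM => //; exact: cF.
Qed.

End Continuity.

(** * Functions of class C^N on R^n *)

Section Directional.
Variables (R : realType) (n : nat).
Implicit Types (f g : 'rV[R]_n -> R) (x v e : 'rV[R]_n).

Lemma is_derive_line f x v (s d : R) :
  is_derive (x + s *: v) v f d -> is_derive s 1 (fun s => f (x + s *: v)) d.
Proof.
move=> fd.
have E : (fun h : R => h^-1 *: (f (x + (h *: (1:R) + s) *: v) - f (x + s *: v))) =
         (fun h : R => h^-1 *: (f (h *: v + (x + s *: v)) - f (x + s *: v))).
  apply/funext => h; congr (_ *: (f _ - _)).
  by rewrite scalerDl /GRing.scale/= mulr1 addrCA.
apply: DeriveDef.
  by have := @ex_derive _ _ _ _ _ _ _ fd; rewrite /derivable/= E.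
by have := @derive_val _ _ _ _ _ _ _ fd; rewrite /derive/= E.
Qed.

Lemma mvt_line f x v (b : R) : 0 <= b ->
  (forall s, 0 <= s <= b -> derivable f (x + s *: v) v) ->
  exists2 s, 0 <= s <= b & f (x + b *: v) - f x = b * 'D_v f (x + s *: v).
Proof.
move=> b0 df.
have D s : 0 <= s <= b -> is_derive s 1 (fun s => f (x + s *: v)) ('D_v f (x + s *: v)).
  by move=> sb; apply: is_derive_line; apply: derivableP; exact: df.
have D' s : s \in `]0, b[%R -> is_derive s 1 (fun s => f (x + s *: v)) ('D_v f (x + s *: v)).
  by rewrite in_itv/= => /andP[s0 sb]; apply: D; rewrite !ltW.
have C : {within `[0, b], continuous (fun s => f (x + s *: v))}.
  apply: derivable_within_continuous => s; rewrite in_itv/= => sb.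
  by apply: ex_derive; exact: D.
have [s sb E] := MVT_segment b0 D' C.
exists s; first by move: sb; rewrite in_itv.
by move: E; rewrite scale0r addr0 subr0 mulrC => ->.
Qed.

Lemma mvt_line_signed f x v (b : R) : (forall y, derivable f y v) ->
  exists2 s, `|s| <= `|b| & f (x + b *: v) - f x = b * 'D_v f (x + s *: v).
Proof.
move=> df; have [b0|b0] := leP 0 b.
  have [s /andP[s0 sb] E] := mvt_line b0 (fun s _ => df (x + s *: v)).
  by exists s => //; rewrite !ger0_norm.
(* For b < 0 the segment is traversed from its other end. *)
have b0' : 0 <= - b by rewrite oppr_ge0 ltW.
have [s /andP[s0 sb] E] := mvt_line b0' (fun s _ => df (x + b *: v + s *: v)).
exists (b + s).
  by rewrite (ler0_norm (ltW b0)) ler_norml opprK lerDl s0/= -lerBrDl (le_trans sb)// lerDl.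
move: E; rewrite -addrA -scalerDl subrr scale0r addr0 -addrA -scalerDl => E.
by rewrite -[LHS]opprB E mulNr opprK.
Qed.

(* Adding one coordinate direction at a time, by the mean value theorem; this
   is the usual proof that C^1 functions are differentiable. *)
Lemma is_derive_addZ f x u e (c d : R) :
  (forall y, derivable f y e) -> {for x, continuous (fun y => 'D_e f y)} ->
  is_derive x u f d -> is_derive x (u + c *: e) f (d + c * 'D_e f x).
Proof.
move=> df ce fu.
suff H : h^-1 *: (f (h *: (u + c *: e) + x) - f x) @[h --> 0^'] --> d + c * 'D_e f x.
  by apply: DeriveDef; [apply/cvg_ex; exists (d + c * 'D_e f x)|exact: (cvg_lim _ H)].
have H1 : h^-1 *: (f (h *: u + x) - f x) @[h --> 0^'] --> d.
  by case: fu => fd <-; exact: fd.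
have H2 : h^-1 *: (f (h *: (u + c *: e) + x) - f (h *: u + x)) @[h --> 0^'] --> c * 'D_e f x.
  apply/cvgrPdist_le => eps eps0.
  have c1 : 0 < `|c| + 1 by rewrite ltr_wpDl.
  have /cvgrPdist_le/(_ (eps / (`|c| + 1))) := ce.
  rewrite divr_gt0// => /(_ isT)/nbhs_ballP[r /= r0 Hr].
  have M0 : 0 < `|u| + `|c| * `|e| + 1 by rewrite ltr_wpDl// addr_ge0// mulr_ge0.
  near=> h.
  have h0 : h != 0 by near: h; exact: nbhs_dnbhs_neq.
  (* This keeps the intermediate point x + h u + s e, with |s| <= |h c|, within r of x. *)
  have hr : `|h| < r / (`|u| + `|c| * `|e| + 1).
    near: h; apply: dnbhs0_lt; rewrite divr_gt0//.
  have [s sb E] := mvt_line_signed (h *: u + x) (h * c) df.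
  have -> : h *: (u + c *: e) + x = h *: u + x + (h * c) *: e.
    by rewrite scalerDr scalerA addrAC.
  rewrite E /GRing.scale/= [h^-1 * _]mulrA [h^-1 * _]mulrA mulVf// mul1r -mulrBr normrM.
  have : `|c| * (eps / (`|c| + 1)) <= eps.
    by rewrite mulrCA ger_pMr// ler_pdivrMr// mul1r lerDl.
  apply: le_trans; apply: ler_wpM2l => //; apply: Hr.
  rewrite -ball_normE /ball_/= -addrA addrCA opprD addNKr normrN.
  apply: (le_lt_trans (ler_normD _ _)); rewrite !normrZ.
  rewrite ltr_pdivlMr// in hr; apply: le_lt_trans hr.
  rewrite mulrDr mulrDr mulr1 -addrA lerD2l.
  rewrite (le_trans (ler_wpM2r (normr_ge0 e) sb))// normrM mulrA lerDl//.
rewrite (_ : (fun h => _) = (fun h : R => h^-1 *: (f (h *: u + x) - f x) +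
    h^-1 *: (f (h *: (u + c *: e) + x) - f (h *: u + x)))); first exact: cvgD.
by apply/funext => h; rewrite -scalerDr; congr (_ *: _); rewrite [RHS]addrC addrA subrK.
Unshelve. all: by end_near. Qed.

(** v is rebuilt as the sum of its coordinate vectors, [is_derive_addZ] contributing one of them at
    each step. *)
Lemma is_derive_Cn1 f x v : Cn 1 f ->
  is_derive x v f (\sum_j v 0 j * 'D_(delta_mx 0 j) f x).
Proof.
case=> cf df.
rewrite {1}[v]row_sum_delta.
elim/big_rec2 : _ => [|j d u _ fu]; first exact: is_derive0.
rewrite addrC [X in is_derive _ _ _ X]addrC; apply: is_derive_addZ => //.
  exact: (df j).1.
by case: (df j) => _ [+ _]; apply.
Qed.

Lemma derive_Cn1 f x v : Cn 1 f ->
  'D_v f x = \sum_j v 0 j * 'D_(delta_mx 0 j) f x.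
Proof. by move=> /(@is_derive_Cn1 _ x v)[]. Qed.

Lemma CnW N f : Cn N.+1 f -> Cn N f.
Proof.
elim: N f => [|N IH] f [cf df]; split=> // j.
by have [dfj /IH] := df j.
Qed.

Lemma Cn_leq M N f : (M <= N)%N -> Cn N f -> Cn M f.
Proof.
move=> /subnK <-; elim: (N - M)%N => [//|k IH]; rewrite addSn => /CnW.
exact: IH.
Qed.

Lemma Cn_continuous N f : Cn N f -> continuous f.
Proof. by case: N => [|N] []. Qed.

Lemma Cn_derivable N f x (v : 'rV[R]_n) : Cn N.+1 f -> derivable f x v.
Proof. by move=> /(@Cn_leq 1 N.+1 f isT) /(@is_derive_Cn1 _ x v) []. Qed.
Arguments Cn_derivable {N f} x v _.

Lemma Cn_derive N f j : Cn N.+1 f -> Cn N (fun x => 'D_(delta_mx 0 j) f x).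
Proof. by case=> _ /(_ j) []. Qed.

Lemma CnS N f (df : 'I_n -> 'rV[R]_n -> R) :
  continuous f -> (forall j x, is_derive x (delta_mx 0 j) f (df j x)) ->
  (forall j, Cn N (df j)) -> Cn N.+1 f.
Proof.
move=> cf fd dfN; split=> // j; split; first by move=> x; case: (fd j x).
rewrite (_ : (fun x => _) = df j)//; apply/funext => x.
by case: (fd j x).
Qed.

Lemma Cn_cst N (c : R) : Cn N (fun _ : 'rV[R]_n => c).
Proof.
have C (b : R) : continuous (fun _ : 'rV[R]_n => b) by exact: cst_continuous.
elim: N c => [|N IH] c; first by split.
by apply: (@CnS _ _ (fun _ _ => 0)).
Qed.

Lemma CnD N f g : Cn N f -> Cn N g -> Cn N (fun x => f x + g x).
Proof.
elim: N f g => [|N IH] f g fN gN.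
  by split=> // x; apply: for_continuousD; [exact: (Cn_continuous fN)|exact: (Cn_continuous gN)].
apply: (@CnS _ _ (fun j x => 'D_(delta_mx 0 j) f x + 'D_(delta_mx 0 j) g x)).
- by move=> x; apply: for_continuousD; [exact: (Cn_continuous fN)|exact: (Cn_continuous gN)].
- move=> j x; apply: is_deriveD; apply: derivableP.
    exact: (Cn_derivable _ _ fN).
  exact: (Cn_derivable _ _ gN).
- by move=> j; apply: IH; exact: Cn_derive.
Qed.

Lemma CnM N f g : Cn N f -> Cn N g -> Cn N (fun x => f x * g x).
Proof.
elim: N f g => [|N IH] f g fN gN.
  by split=> // x; apply: for_continuousM; [exact: (Cn_continuous fN)|exact: (Cn_continuous gN)].
apply: (@CnS _ _ (fun j x => f x * 'D_(delta_mx 0 j) g x + g x * 'D_(delta_mx 0 j) f x)).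
- by move=> x; apply: for_continuousM; [exact: (Cn_continuous fN)|exact: (Cn_continuous gN)].
- move=> j x; have df := derivableP (Cn_derivable x (delta_mx 0 j) fN).
  have dg := derivableP (Cn_derivable x (delta_mx 0 j) gN).
  exact: is_deriveM.
- by move=> j; apply: CnD; apply: IH; (exact: CnW || exact: Cn_derive).
Qed.

Lemma CnN N f : Cn N f -> Cn N (fun x => - f x).
Proof.
move=> fN; rewrite (_ : (fun x => _) = (fun x => (-1) * f x)).
  by apply: CnM => //; exact: Cn_cst.
by apply/funext => x; rewrite mulN1r.
Qed.

(** Only the restriction of f to the line through x in direction v matters, so the one-variable
    chain rule applies at parameter 0. *)
Lemma is_derive_comp1 f x v (g : R -> R) (d e : R) :
  is_derive x v f d -> is_derive (f x) 1 g e -> is_derive x v (fun x => g (f x)) (d * e).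
Proof.
move=> fd ge.
have E : (fun h : R => h^-1 *: (g (f (h *: v + x)) - g (f x))) =
         (fun h : R => h^-1 *: ((g \o (fun s : R => f (s *: v + x))) (h *: (1 : R) + 0) -
                               (g \o (fun s : R => f (s *: v + x))) 0)).
  by apply/funext => h /=; rewrite scale0r add0r addr0 [h *: 1]mulr1.
have fd0 : is_derive (0 : R) 1 (fun s : R => f (s *: v + x)) d.
  have := @is_derive_line f x v 0 d; rewrite scale0r addr0 => /(_ fd).
  by under eq_fun do rewrite addrC.
have ge0 : is_derive (f ((0 : R) *: v + x)) 1 g e by rewrite scale0r add0r.
have [gd gv] := is_derive1_comp ge0 fd0.
apply: DeriveDef; first by rewrite /derivable/= E.
by rewrite /derive/= E mulrC; exact: gv.
Qed.

Lemma CnV N f : (forall x, f x != 0) -> Cn N f -> Cn N (fun x => (f x)^-1).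
Proof.
move=> f0; elim: N => [|N IH] fN.
  by split=> // x; apply: for_continuousV => //; exact: (Cn_continuous fN).
(* The square is written as a product of two inverses, to each of which the induction hypothesis
   applies. *)
apply: (@CnS _ _ (fun j x => - ('D_(delta_mx 0 j) f x * ((f x)^-1 * (f x)^-1)))).
- by move=> x; apply: for_continuousV => //; exact: (Cn_continuous fN).
- move=> j x; have [df <-] := derivableP (Cn_derivable x (delta_mx 0 j) fN).
  apply: DeriveDef; first exact: derivableV.
  by rewrite deriveV// [LHS]mulNr mulrC -exprVn expr2.
- move=> j; apply/CnN/CnM; first exact: Cn_derive.
  by apply: CnM; apply: IH; exact: CnW.
Qed.

Lemma is_derive_ln_comp f x v d : 0 < f x -> is_derive x v f d ->
  is_derive x v (fun x => ln (f x)) (d * (f x)^-1).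
Proof. by move=> f0 fd; apply: is_derive_comp1 => //; exact: is_derive1_ln. Qed.

Lemma Cn_ln N f : (forall x, 0 < f x) -> Cn N f -> Cn N (fun x => ln (f x)).
Proof.
move=> f0.
have C M : Cn M f -> continuous (fun x => ln (f x)).
  move=> fM x; apply: for_continuous_comp; first exact: (Cn_continuous fM).
  exact: continuous_ln.
case: N => [|N] fN; first by split=> //; exact: (C _ fN).
apply: (@CnS _ _ (fun j x => 'D_(delta_mx 0 j) f x * (f x)^-1)).
- exact: (C _ fN).
- move=> j x; apply: is_derive_ln_comp => //.
  exact/derivableP/(Cn_derivable _ _ fN).
- move=> j; apply: CnM; first exact: Cn_derive.
  by apply: CnV; [move=> x; rewrite gt_eqF|exact: CnW].
Qed.

Lemma Cn_sum N (I : Type) (r : seq I) (P : pred I) (F : I -> 'rV[R]_n -> R) :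
  (forall i, P i -> Cn N (F i)) -> Cn N (fun x => \sum_(i <- r | P i) F i x).
Proof.
move=> FN; elim: r => [|i r IH].
  have -> : (fun x => \sum_(i <- [::] | P i) F i x) = (fun _ => 0).
    by apply/funext => x; rewrite big_nil.
  exact: Cn_cst.
have -> : (fun x => \sum_(i <- i :: r | P i) F i x) =
    (fun x => (if P i then F i x else 0) + \sum_(i <- r | P i) F i x).
  by apply/funext => x; rewrite [LHS]big_cons; case: (P i) => //; rewrite add0r.
by apply: CnD => //; case Pi : (P i); [exact: FN|exact: Cn_cst].
Qed.

End Directional.

Arguments Cn_derivable {R n N f} x v _.

(** * Continuity and derivatives of linear substitutions *)

Section Linear.
Variables (R : realType).

Lemma continuous_rV (T : topologicalType) n (f : T -> 'rV[R]_n) x :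
  (forall j, continuous_at x (fun y => f y 0 j)) -> continuous_at x f.
Proof.
move=> cf U /= [B HB BU].
have H : \forall y \near x, forall j, B 0 j (f y 0 j).
  by apply: filter_forall => j; exact: cf (HB 0 j).
by apply: filterS H => y By; apply: BU => i j; rewrite ord1; exact: By.
Qed.

Lemma continuous_mulmxr n m (A : 'M[R]_(n, m)) : continuous (fun x : 'rV[R]_n => x *m A).
Proof.
move=> x; apply: continuous_rV => j; under eq_fun do rewrite mxE.
apply: for_continuous_sum => k _; apply: for_continuousM; last exact: cst_continuous.
exact: coord_continuous.
Qed.

(** Moving x along the j-th basis vector moves x A along row j of A, so this is the derivative of f
    in that direction. *)
Lemma derive_mulmxr n m (A : 'M[R]_(n, m)) (f : 'rV[R]_m -> R) x j :
  Cn 1 f -> is_derive x (delta_mx 0 j) (fun x => f (x *m A))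
    (\sum_l A j l * 'D_(delta_mx 0 l) f (x *m A)).
Proof.
move=> f1.
have [fd fv] := is_derive_Cn1 (x *m A) (row j A) f1.
have E : (fun h : R => h^-1 *: (f ((h *: delta_mx 0 j + x) *m A) - f (x *m A))) =
         (fun h : R => h^-1 *: (f (h *: row j A + x *m A) - f (x *m A))).
  by apply/funext => h; rewrite mulmxDl -scalemxAl -rowE.
apply: DeriveDef; first by rewrite /derivable/= E.
rewrite /derive/= E; apply: etrans fv _.
by apply: eq_bigr => l _; rewrite mxE.
Qed.

Lemma Cn_mulmxr N n m (A : 'M[R]_(n, m)) (f : 'rV[R]_m -> R) :
  Cn N f -> Cn N (fun x => f (x *m A)).
Proof.
elim: N f => [|N IH] f fN.
  split=> // x; apply: for_continuous_comp; first exact: continuous_mulmxr.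
  exact: (Cn_continuous fN).
apply: (@CnS _ _ _ _ (fun j x => \sum_l A j l * 'D_(delta_mx 0 l) f (x *m A))).
- move=> x; apply: for_continuous_comp; first exact: continuous_mulmxr.
  exact: (Cn_continuous fN).
- by move=> j x; apply: derive_mulmxr; exact: (@Cn_leq _ _ 1 N.+1).
- move=> j; apply: Cn_sum => l _; apply: CnM; first exact: Cn_cst.
  by apply: (IH (fun y => 'D_(delta_mx 0 l) f y)); exact: Cn_derive.
Qed.

Lemma is_derive_dotrv n (u x : 'rV[R]_n) j :
  is_derive x (delta_mx 0 j) (fun x => dotrv u x) (u 0 j).
Proof.
have E : (fun h : R => h^-1 *: (dotrv u (h *: delta_mx 0 j + x) - dotrv u x)) =
         (fun h : R => h^-1 *: (h *: u 0 j)).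
  apply/funext => h; congr (_ *: _); rewrite /dotrv -sumrB (bigD1 j)//= big1 => [|i ij].
    by rewrite !mxE !eqxx mulr1 mulrDr addrK addr0 mulrC.
  by rewrite !mxE eqxx (negPf ij) mulr0 add0r subrr.
have C : h^-1 *: (dotrv u (h *: delta_mx 0 j + x) - dotrv u x) @[h --> 0^'] --> u 0 j.
  rewrite E; apply: cvg_near_cst; near=> h; rewrite scalerA mulVf ?scale1r//.
  by near: h; exact: nbhs_dnbhs_neq.
by apply: DeriveDef; [apply/cvg_ex; exists (u 0 j)|exact: (cvg_lim _ C)].
Unshelve. all: by end_near. Qed.

Lemma Cn_dotrv N n (u : 'rV[R]_n) : Cn N (fun x => dotrv u x).
Proof.
have C : continuous (fun x => dotrv u x).
  move=> x; apply: for_continuous_sum => k _; apply: for_continuousM.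
    exact: cst_continuous.
  exact: coord_continuous.
case: N => [|N]; first by split.
apply: (@CnS _ _ _ _ (fun j _ => u 0 j)) => // [j x|j]; first exact: is_derive_dotrv.
exact: Cn_cst.
Qed.

End Linear.

(** * Hessians, Taylor and Lipschitz estimates *)

Section Hessian.
Variables (R : realType).

Definition hess n (f : 'rV[R]_n -> R) (x : 'rV[R]_n) : 'M[R]_n :=
  \matrix_(j, l) 'D_(delta_mx 0 j) (fun y => 'D_(delta_mx 0 l) f y) x.

Lemma hess_mulmxr n m (A : 'M[R]_(n, m)) (f : 'rV[R]_m -> R) x :
  Cn 2 f -> hess (fun x => f (x *m A)) x = A *m hess f (x *m A) *m A^T.
Proof.
move=> f2; apply/matrixP => j l; rewrite !mxE.
have -> : (fun y => 'D_(delta_mx 0 l) (fun x => f (x *m A)) y) =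
          (fun y => \sum_p A l p * 'D_(delta_mx 0 p) f (y *m A)).
  by apply/funext => y; case: (derive_mulmxr A y l (@Cn_leq _ _ 1 2 f isT f2)).
have D p := derive_mulmxr A x j (Cn_derive p f2).
transitivity (\sum_p A l p * (\sum_q A j q *
    'D_(delta_mx 0 q) (fun y => 'D_(delta_mx 0 p) f y) (x *m A))).
  rewrite (_ : (fun y => _) = \sum_p (A l p \*: (fun y => 'D_(delta_mx 0 p) f (y *m A)))).
    rewrite derive_sum => [|p].
      by apply: eq_bigr => p _; rewrite deriveZ; case: (D p) => // _ ->.
    by apply: derivableZ; case: (D p).
  by apply/funext => y; rewrite fct_sumE.
apply: eq_bigr => p _; rewrite !mxE mulrC; congr (_ * _).
by apply: eq_bigr => q _; rewrite !mxE.
Qed.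

(** The mean value theorem is used twice, for f and then for its derivative along v. Bounding the
    intermediate parameter s by 1 puts C where Taylor's formula has C / 2. *)
Lemma taylor2_le n (f : 'rV[R]_n -> R) (x v : 'rV[R]_n) (C : R) : Cn 2 f -> 0 <= C ->
  (forall y, \sum_j \sum_l v 0 j * v 0 l * hess f y j l <= C) ->
  f (x + v) <= f x + \sum_j v 0 j * 'D_(delta_mx 0 j) f x + C.
Proof.
move=> f2 C0 fC.
have f1 := @Cn_leq _ _ 1 2 f isT f2.
have [s sb E] := @mvt_line _ _ f x v 1 ler01 (fun s _ => @Cn_derivable _ _ 0 f _ v f1).
rewrite scale1r mul1r in E.
pose g y := \sum_j v 0 j * 'D_(delta_mx 0 j) f y.
have g1 : Cn 1 g.
  by apply: Cn_sum => j _; apply: CnM; [exact: Cn_cst|exact: Cn_derive].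
have gE y : 'D_v f y = g y by exact: derive_Cn1.
have [s0 s1] := andP sb.
have [r rb E'] := @mvt_line _ _ g x v s s0 (fun s _ => @Cn_derivable _ _ 0 g _ v g1).
rewrite -lerBlDl opprD addrA E gE -/(g x) E'.
have : 'D_v g (x + r *: v) <= C.
  rewrite derive_Cn1//; apply: le_trans (fC (x + r *: v)).
  apply: ler_sum => j _; rewrite (_ : 'D_ _ _ _ = \sum_l v 0 l * hess f (x + r *: v) j l).
    by rewrite mulr_sumr; apply: ler_sum => l _; rewrite mulrA.
  rewrite (_ : g = \sum_l (v 0 l \*: (fun y => 'D_(delta_mx 0 l) f y))).
    rewrite derive_sum => [|l].
      apply: eq_bigr => l _; rewrite mxE deriveZ//.
      exact/(@Cn_derivable _ _ 0)/Cn_derive.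
    by apply: derivableZ; exact/(@Cn_derivable _ _ 0)/Cn_derive.
  by apply/funext => y; rewrite fct_sumE.
move=> DC; apply: le_trans (ler_wpM2l s0 DC) _.
by rewrite -[leRHS]mul1r ler_wpM2r.
Qed.

Lemma lipschitz_Cn1 n (f : 'rV[R]_n -> R) (x v : 'rV[R]_n) (C : R) : Cn 1 f ->
  (forall s j, 0 <= s <= 1 -> `|'D_(delta_mx 0 j) f (x + s *: v)| <= C) ->
  `|f (x + v) - f x| <= \sum_j `|v 0 j| * C.
Proof.
move=> f1 fC.
have [s sb E] := @mvt_line _ _ f x v 1 ler01 (fun s _ => @Cn_derivable _ _ 0 f _ v f1).
rewrite scale1r mul1r derive_Cn1// in E; rewrite E.
apply: le_trans (ler_norm_sum _ _ _) _; apply: ler_sum => j _.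
by rewrite normrM ler_wpM2l// fC.
Qed.

End Hessian.

(** * Logarithmic coordinates *)

Section LogCoordinates.
Variable (R : realType).

Lemma is_derive_subc (V : normedModType R) (f : V -> R) x v (c d : R) :
  is_derive x v f d -> is_derive x v (fun y => f y - c) d.
Proof.
move=> fd; have := @is_deriveB _ _ _ f (cst c) x v d 0 fd (is_derive_cst c x v).
by rewrite subr0.
Qed.

(** The exponential and logarithmic changes of coordinates act on each coordinate separately, so
    they send a coordinate line into a line with a new parametrization g; the one-variable chain
    rule then suffices. *)
Lemma is_derive_along n m (f : 'rV[R]_n -> R) (T : 'rV[R]_m -> 'rV[R]_n) (x v : 'rV[R]_m)
    (w : 'rV[R]_n) (g : R -> R) (d e : R) :
  (forall h, T (h *: v + x) = T x + g h *: w) -> g 0 = 0 ->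
  is_derive (0 : R) 1 g d -> is_derive (T x) w f e ->
  is_derive x v (fun y => f (T y)) (d * e).
Proof.
move=> Tg g0 gd fe.
have fe0 : is_derive (g 0) 1 (fun s : R => f (T x + s *: w)) e.
  by apply: is_derive_line; rewrite g0 scale0r addr0.
have E : (fun h : R => h^-1 *: (f (T (h *: v + x)) - f (T x))) =
         (fun h : R => h^-1 *: (((fun s : R => f (T x + s *: w)) \o g) (h *: (1 : R) + 0) -
                               ((fun s : R => f (T x + s *: w)) \o g) 0)).
  by apply/funext => h /=; rewrite Tg g0 scale0r !addr0 [h *: 1]mulr1.
have [gfd gfv] := is_derive1_comp fe0 gd.
apply: DeriveDef; first by rewrite /derivable/= E.
by rewrite /derive/= E mulrC; exact: gfv.
Qed.

Variable m : nat.

(* The real point w_j = e^(xi_j / 2) of the chart, where xi_j = log |w_j|^2. *)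
Definition expemb (xi : 'rV[R]_m) : 'rV[R]_(m + m) :=
  row_mx (\row_j expR (xi 0 j / 2)) 0.

Definition abs2 (j : 'I_m) (p : 'rV[R]_(m + m)) : R :=
  p 0 (lshift m j) ^+ 2 + p 0 (rshift m j) ^+ 2.

Definition logabs2 (p : 'rV[R]_(m + m)) : 'rV[R]_m := \row_j ln (abs2 j p).

Lemma expembE_l xi j : expemb xi 0 (lshift m j) = expR (xi 0 j / 2).
Proof. by rewrite row_mxEl mxE. Qed.

Lemma expembE_r xi j : expemb xi 0 (rshift m j) = 0.
Proof. by rewrite row_mxEr mxE. Qed.

Lemma abs2_expemb xi j : abs2 j (expemb xi) = expR (xi 0 j).
Proof.
rewrite /abs2 expembE_l expembE_r expr0n addr0 -expRM_natl -mulr_natl.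
by rewrite mulrC divfK.
Qed.

Lemma logabs2_expemb xi : logabs2 (expemb xi) = xi.
Proof. by apply/rowP => j; rewrite mxE abs2_expemb expRK. Qed.

Lemma is_derive_expemb (f : 'rV[R]_(m + m) -> R) xi j d :
  is_derive (expemb xi) (delta_mx 0 (lshift m j)) f d ->
  is_derive xi (delta_mx 0 j) (fun xi => f (expemb xi)) (expR (xi 0 j / 2) / 2 * d).
Proof.
pose g (h : R) := expR ((xi 0 j + h) / 2) - expR (xi 0 j / 2).
apply: (@is_derive_along _ _ _ _ _ _ _ g).
- move=> h; apply/rowP => i; rewrite !mxE eqxx/=.
  case: (split_ordP i) => k ->.
    rewrite !mxE eq_lshift; have [->|kj] := eqVneq k j.
      by rewrite !mulr1 [RHS]addrC subrK [h + _]addrC.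
    by rewrite !mulr0 addr0 add0r.
  by rewrite !mxE eq_rlshift mulr0 addr0.
- by rewrite /g addr0 subrr.
- have e1 : is_derive (0 : R) 1 (fun h => (xi 0 j + h) / 2) (2^-1).
    have -> : (fun h => (xi 0 j + h) / 2) = cst (xi 0 j / 2) + 2^-1 \*: (@idfun R).
      by apply/funext => h; rewrite mulrDl [h / 2]mulrC.
    by apply: is_derive_eq; rewrite add0r [_ *: _]mulr1.
  have e2 := is_derive_expR ((xi 0 j + 0) / 2).
  rewrite addr0 in e2.
  apply: is_derive_subc; apply: (@is_derive1_comp _ expR) => //.
  by rewrite addr0.
Qed.

(* [side b j] indexes the real ([b = false]) or imaginary part of the j-th
   complex coordinate. *)
Definition side (b : bool) (j : 'I_m) : 'I_(m + m) :=
  if b then rshift m j else lshift m j.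

Lemma side_eq b j b' l : (side b j == side b' l) = (b == b') && (j == l).
Proof.
by case: b b' => [] []; rewrite /side ?eq_lshift ?eq_rshift ?eq_lrshift ?eq_rlshift.
Qed.

Lemma is_derive_coord n (x : 'rV[R]_n) (a b : 'I_n) :
  is_derive x (delta_mx 0 a) (fun y => y 0 b) (a == b)%:R.
Proof.
have -> : (fun y : 'rV[R]_n => y 0 b) = dotrv (delta_mx 0 b).
  apply/funext => y; rewrite /dotrv (bigD1 b)//= big1 => [|i ib].
    by rewrite mxE !eqxx mul1r addr0.
  by rewrite mxE (negPf ib) andbF mul0r.
have := @is_derive_dotrv R n (delta_mx 0 b) x a.
by rewrite mxE eqxx.
Qed.

Lemma abs2_side b j p : abs2 j p = p 0 (side b j) ^+ 2 + p 0 (side (~~ b) j) ^+ 2.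
Proof. by case: b => //; rewrite /abs2 addrC. Qed.

Lemma is_derive_abs2 b j l p :
  is_derive p (delta_mx 0 (side b j)) (abs2 l) (2 * p 0 (side b l) *+ (j == l)).
Proof.
have -> : abs2 l = (fun y => y 0 (side b l)) ^+ 2 + (fun y => y 0 (side (~~ b) l)) ^+ 2.
  by apply/funext => q; rewrite (abs2_side b).
have d1 := is_derive_coord p (side b j) (side b l).
have d2 := is_derive_coord p (side b j) (side (~~ b) l).
apply: is_derive_eq; rewrite !side_eq eqxx (_ : (b == ~~ b) = false)/=; last by case: (b).
rewrite scaler0 addr0.
by case: (j == l); rewrite /GRing.scale/= ?mulr1n ?mulr0n; ring.
Qed.

Lemma is_derive_logabs2 (f : 'rV[R]_m -> R) b j p d : 0 < abs2 j p ->
  is_derive (logabs2 p) (delta_mx 0 j) f d ->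
  is_derive p (delta_mx 0 (side b j)) (fun q => f (logabs2 q))
    (2 * p 0 (side b j) / abs2 j p * d).
Proof.
move=> p0.
pose g (h : R) := ln (abs2 j (h *: delta_mx 0 (side b j) + p)) - ln (abs2 j p).
apply: (@is_derive_along _ _ _ _ _ _ _ g).
- move=> h; apply/rowP => i; rewrite !mxE eqxx/=.
  have [->|ij] := eqVneq i j; first by rewrite mulr1 [RHS]addrC subrK.
  rewrite mulr0 addr0 !(abs2_side b) !mxE eqxx/= !side_eq (negPf ij) !andbF.
  by rewrite !mulr0 !add0r.
- by rewrite /g scale0r add0r subrr.
- have d1 := is_derive_abs2 b j j p; rewrite eqxx mulr1n in d1.
  have d2 := is_derive_ln_comp p0 d1.
  have d3 : is_derive (0 : R) 1 (fun h => ln (abs2 j (p + h *: delta_mx 0 (side b j))))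
     (2 * p 0 (side b j) / abs2 j p).
    have := @is_derive_line _ _ (fun q => ln (abs2 j q)) p (delta_mx 0 (side b j)) 0.
    by rewrite scale0r addr0; apply.
  by apply: is_derive_subc; under eq_fun do rewrite addrC.
Qed.

Lemma continuous_abs2 j : continuous (abs2 j).
Proof.
move=> p.
have c i : continuous_at p (fun q : 'rV[R]_(m + m) => q 0 i) by exact: coord_continuous.
exact: (for_continuousD (for_continuousX (k := 2) (c _)) (for_continuousX (k := 2) (c _))).
Qed.

Lemma near_abs2_gt0 p : (forall j, 0 < abs2 j p) -> \near p, forall j, 0 < abs2 j p.
Proof.
move=> p0.
have := @filter_forall _ _ (fun j q => 0 < abs2 j q) (nbhs p) _; apply => j.
exact: (cvgr_gt _ (@continuous_abs2 j p) _ (p0 j)).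
Qed.

(** The chain rule through xi_j = log |w_j|^2, whose derivative in a real coordinate p_a of w_j is 2
    p_a / |w_j|^2; the last term carries the second derivatives of xi_l. *)
Lemma derive2_logabs2 (f : 'rV[R]_m -> R) (phi : 'rV[R]_(m + m) -> R) b j b' l p :
  Cn 2 f -> (forall q, (forall j, 0 < abs2 j q) -> phi q = f (logabs2 q)) ->
  (forall j, 0 < abs2 j p) ->
  'D_(delta_mx 0 (side b j)) (fun q => 'D_(delta_mx 0 (side b' l)) phi q) p =
  4 * p 0 (side b j) * p 0 (side b' l) / (abs2 j p * abs2 l p) * hess f (logabs2 p) j l
  + (2 * (b == b')%:R / abs2 l p - 4 * p 0 (side b l) * p 0 (side b' l) / abs2 l p ^+ 2) *+ (j == l)
    * 'D_(delta_mx 0 l) f (logabs2 p).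
Proof.
move=> f2 phiE p0.
have f1 := @Cn_leq _ _ 1 2 f isT f2.
(* [phi] is given by [f] only off the coordinate hyperplanes; this set is open, and derivatives are
   local. *)
have -> : 'D_(delta_mx 0 (side b j)) (fun q => 'D_(delta_mx 0 (side b' l)) phi q) p =
   'D_(delta_mx 0 (side b j)) (fun q : 'rV[R]_(m + m) => 2 * q 0 (side b' l) * (abs2 l q)^-1 *
      'D_(delta_mx 0 l) f (logabs2 q)) p.
  apply: near_eq_derive; near=> q.
  have q0 : forall j, 0 < abs2 j q by near: q; exact: near_abs2_gt0.
  have D := @is_derive_logabs2 f b' l q _ (q0 l)
    (derivableP (Cn_derivable (logabs2 q) (delta_mx 0 l) f1)).
  case: D => _ <-; apply: near_eq_derive; near=> r.
  by apply: phiE; near: r; exact: near_abs2_gt0.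
have d1 := @is_derive_logabs2 (fun y => 'D_(delta_mx 0 l) f y) b j p _ (p0 j)
   (derivableP (Cn_derivable (logabs2 p) (delta_mx 0 j) (Cn_derive l f2))).
have d2 := is_derive_abs2 b j l p.
have d3 := is_derive_coord p (side b j) (side b' l).
have l0 : abs2 l p != 0 by rewrite gt_eqF.
have d4 : is_derive p (delta_mx 0 (side b j)) (fun q => (abs2 l q)^-1)
   (- (abs2 l p) ^- 2 * (2 * p 0 (side b l) *+ (j == l))).
  by case: d2 => d2 <-; apply: DeriveDef; [exact: derivableV|rewrite deriveV].
rewrite (_ : (fun q => _) = (((2 : R) \*: (fun q : 'rV[R]_(m + m) => q 0 (side b' l))) *
  (fun q => (abs2 l q)^-1)) * (fun q => 'D_(delta_mx 0 l) f (logabs2 q)))//.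
rewrite derive_val.
rewrite /GRing.scale/= side_eq !mxE.
rewrite -[(_ * _) p]/(2 * p 0 (side b' l) * (abs2 l p)^-1) -[_ *: p 0 _]/(2 * p 0 (side b' l)).
have j0 : abs2 j p != 0 by rewrite gt_eqF.
case: (j == l); rewrite ?mulr1n ?mulr0n ?andbT ?andbF /=.
  by field; rewrite l0 j0.
by field; rewrite l0 j0.
Unshelve. all: by end_near. Qed.

Definition cartesian (p : 'rV[R]_(m + m)) (j : 'I_m) : R[i] :=
  p 0 (lshift m j) +i* p 0 (rshift m j).

(* The first derivatives of f do not contribute, as log |w|^2 is harmonic. *)
Lemma complex_hessian_logabs2 (f : 'rV[R]_m -> R) (phi : 'rV[R]_(m + m) -> R) p :
  Cn 2 f -> (forall q, (forall j, 0 < abs2 j q) -> phi q = f (logabs2 q)) ->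
  (forall j, 0 < abs2 j p) ->
  complex_hessian phi p =
  \matrix_(j, l) ((cartesian p j)^* / (abs2 j p)%:C * (hess f (logabs2 p) j l)%:C
                   * (cartesian p l / (abs2 l p)%:C)).
Proof.
move=> f2 phiE p0; apply/matrixP => j l; rewrite !mxE.
have D b b' := derive2_logabs2 b j b' l f2 phiE p0.
have /= D1 := D false false; have /= D2 := D true true.
have /= D3 := D false true; have /= D4 := D true false.
rewrite D1 D2 D3 D4.
rewrite -!(fmorphV (real_complex R)).
rewrite /cartesian /=.
have l0 : abs2 l p != 0 by rewrite gt_eqF.
have j0 : abs2 j p != 0 by rewrite gt_eqF.
simpc.
rewrite -/(hess f _); congr (_ +i* _).
  have -> : 2 / abs2 l p - 4 * p 0 (rshift m l) * p 0 (rshift m l) / abs2 l p ^+ 2 =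
     - (2 / abs2 l p - 4 * p 0 (lshift m l) * p 0 (lshift m l) / abs2 l p ^+ 2).
    rewrite -[X in _ - X](addrK (4 * p 0 (lshift m l) * p 0 (lshift m l) / abs2 l p ^+ 2)).
    rewrite -mulrDl -[4 * _ * _ + _](_ : 4 * abs2 l p = _); first by field.
    by rewrite /abs2; ring.
  rewrite mulNrn mulNr addrACA subrr addr0 !mxE.
  by field; rewrite l0 j0.
rewrite !mxE.
have -> : 4 * p 0 (rshift m l) * p 0 (lshift m l) = 4 * p 0 (lshift m l) * p 0 (rshift m l) by ring.
rewrite addrACA subrr addr0.
by field; rewrite l0 j0.
Qed.

(** The complex Hessian is Hess f between diagonal matrices with entries 1 / w_j and 1 / conj(w_j),
    whose determinants multiply to prod |w_j|^-2. *)
Lemma det_complex_hessian_logabs2 (f : 'rV[R]_m -> R) (phi : 'rV[R]_(m + m) -> R) p :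
  Cn 2 f -> (forall q, (forall j, 0 < abs2 j q) -> phi q = f (logabs2 q)) ->
  (forall j, 0 < abs2 j p) ->
  complex.Re (\det (complex_hessian phi p)) =
  \det (hess f (logabs2 p)) * \prod_j (abs2 j p)^-1.
Proof.
move=> f2 phiE p0; rewrite (complex_hessian_logabs2 f2 phiE p0).
pose d1 : 'rV[R[i]]_m := \row_j ((cartesian p j)^* / (abs2 j p)%:C).
pose d2 : 'rV[R[i]]_m := \row_j (cartesian p j / (abs2 j p)%:C).
rewrite (_ : (\matrix_(j, l) _) =
  diag_mx d1 *m map_mx (real_complex R) (hess f (logabs2 p)) *m diag_mx d2); last first.
  by apply/matrixP => j l; rewrite mul_mx_diag mul_diag_mx !mxE.
rewrite !det_mulmx !det_diag det_map_mx mulrAC -big_split/=.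
rewrite (eq_bigr (fun j => ((abs2 j p)^-1)%:C)) => [|j _]; last first.
  rewrite !mxE /cartesian /= -!(fmorphV (real_complex R)) /=; simpc.
  have j0 : abs2 j p != 0 by rewrite gt_eqF.
  congr (_ +i* _); last by ring.
  transitivity (abs2 j p / abs2 j p / abs2 j p); last by rewrite divff// mul1r.
  by rewrite [X in _ = X / _ / _]/abs2; ring.
by rewrite -rmorph_prod -rmorphM /= mulrC.
Qed.

(** At real points the diagonal factors e^(- xi_j / 2) are real. The Hessian determinant thus splits
    into prod |w_j|^2, which degenerates at the divisors, and a determinant that is continuous
    across them and can be bounded below by compactness. *)
Lemma Re_complex_hessian_expemb (f : 'rV[R]_m -> R) (phi : 'rV[R]_(m + m) -> R) xi :
  Cn 2 f -> (forall q, (forall j, 0 < abs2 j q) -> phi q = f (logabs2 q)) ->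
  \det (hess f xi) =
  (\prod_j expR (xi 0 j)) * \det (map_mx (@complex.Re R) (complex_hessian phi (expemb xi))).
Proof.
move=> f2 phiE.
have p0 j : 0 < abs2 j (expemb xi) by rewrite abs2_expemb expR_gt0.
rewrite (complex_hessian_logabs2 f2 phiE p0) logabs2_expemb.
pose d : 'rV[R]_m := \row_j (expR (- (xi 0 j / 2))).
rewrite (_ : map_mx _ _ = diag_mx d *m (hess f xi) *m diag_mx d); last first.
  apply/matrixP => j l; rewrite mul_mx_diag mul_diag_mx.
  have E k : cartesian (expemb xi) k / (abs2 k (expemb xi))%:C = (expR (- (xi 0 k / 2)))%:C.
    rewrite /cartesian expembE_l expembE_r abs2_expemb -(fmorphV (real_complex R)) -expRN.
    simpc; rewrite /= -expRD; congr ((expR _)%:C); lra.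
  have E' k : (cartesian (expemb xi) k)^* / (abs2 k (expemb xi))%:C = (expR (- (xi 0 k / 2)))%:C.
    by rewrite -E /cartesian expembE_r; simpc.
  by rewrite [in LHS]mxE [X in complex.Re X]mxE E E' -!rmorphM /= !mxE.
rewrite !det_mulmx !det_diag mulrAC -big_split/= mulrA -big_split/= big1 ?mul1r// => j _.
by rewrite mxE -!expRD -opprD -splitr addrN expR0.
Qed.

End LogCoordinates.

(** * Determinants of positive matrices *)

Section PositiveDeterminant.

(* The monic polynomial det (X + A) has no root in [0, +oo[. *)
Lemma det_posdef (R : rcfType) m (A : 'M[R]_m) :
  (forall c : 'rV[R]_m, c != 0 -> 0 < \sum_j \sum_l A j l * c 0 j * c 0 l) ->
  0 < \det A.
Proof.
move=> Apos; set p := char_poly (- A).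
have p0 : p.[0] = \det A.
  rewrite horner_coef0 char_poly_det -[- A]scaleN1r detZ mulrA -exprD addnn -mul2n.
  by rewrite exprM sqrrN !expr1n mul1r.
have p_neq0 x : 0 <= x -> p.[x] != 0.
  move=> x0; apply/negP => /eqP px.
  have /eigenvalueP[v vA v0] : eigenvalue (- A) x by rewrite eigenvalue_root_char; apply/eqP.
  have := Apos _ v0.
  have -> : \sum_j \sum_l A j l * v 0 j * v 0 l = (v *m A *m v^T) 0 0.
    rewrite mxE exchange_big/=; apply: eq_bigr => l _; rewrite !mxE mulr_suml.
    by apply: eq_bigr => j _; rewrite [v 0 j * _]mulrC.
  rewrite -[v *m A]opprK -mulmxN vA mulNmx -scalemxAl mxE oppr_gt0 mxE mxE.
  rewrite le_gtF// mulr_ge0// sumr_ge0// => j _; rewrite !mxE.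
  by rewrite -expr2 sqr_ge0.
rewrite ltNge; apply/negP; rewrite -p0 => p0_le0.
have lc : lead_coef p = 1 by exact/monicP/char_poly_monic.
have [|M HM] := @poly_pinfty_gt_lc _ p; first by rewrite lc.
have := HM (Num.max 0 M); rewrite le_max lexx orbT lc => /(_ isT) pM.
have [||y + /rootP py] := @poly_ivt _ p 0 (Num.max 0 M).
- by rewrite le_max lexx.
- by rewrite p0_le0 (le_trans ler01).
by move=> /andP[y0 _]; move: (p_neq0 y y0); rewrite py eqxx.
Qed.

(** det A is the product of the eigenvalues. At a left eigenvector v for z the form takes the value
    z |v|^2, and being positive in R[i] means being real and positive. *)
Lemma Re_det_posdef (R : realType) m (A : 'M[R[i]]_m) :
  (forall c : 'rV[R[i]]_m, c != 0 -> 0 < \sum_j \sum_l A j l * c 0 j * (c 0 l)^* ) ->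
  0 < complex.Re (\det A).
Proof.
move=> Apos; suff : 0 < \det A by rewrite ltcE => /andP[].
have [r Er] := closed_field_poly_normal (char_poly A).
rewrite (monicP (char_poly_monic A)) scale1r in Er.
have size_r : size r = m.
  by have := size_char_poly A; rewrite Er size_prod_XsubC => -[].
have -> : \det A = \prod_(z <- r) z.
  (* Both expressions for the constant coefficient carry the sign (-1)^m, which cancels. *)
  have := char_poly_det A; rewrite -horner_coef0 Er horner_prod.
  rewrite (eq_bigr (fun z => (-1) * z)) => [|z _]; last by rewrite !hornerE mulN1r.
  rewrite big_split/= big_const_seq count_predT size_r iter_mulr_1.
  have n0 : (-1 : R[i]) ^+ m != 0 by rewrite expf_neq0// oppr_eq0 oner_eq0.
  by move=> /(mulfI n0).
rewrite big_seq; apply: prodr_gt0 => z zr.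
have /eigenvalueP[v vA v0] : eigenvalue A z.
  by rewrite eigenvalue_root_char Er root_prod_XsubC.
have := Apos _ v0.
have -> : \sum_j \sum_l A j l * v 0 j * (v 0 l)^* = \sum_l (v *m A) 0 l * (v 0 l)^*.
  rewrite exchange_big/=; apply: eq_bigr => l _; rewrite !mxE mulr_suml.
  by apply: eq_bigr => j _; rewrite [v 0 j * _]mulrC.
rewrite vA; under eq_bigr do rewrite mxE -mulrA.
rewrite -mulr_sumr pmulr_lgt0//.
pose F i := complex.Re (v 0 i) ^+ 2 + complex.Im (v 0 i) ^+ 2.
have F0 i : 0 <= F i by rewrite addr_ge0// sqr_ge0.
have -> : \sum_i v 0 i * (v 0 i)^* = (\sum_i F i)%:C.
  rewrite rmorph_sum; apply: eq_bigr => i _; rewrite /F.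
  by case: (v 0 i) => x y /=; simpc; congr (_ +i* _); ring.
rewrite ltcR lt0r sumr_ge0// andbT psumr_neq0//.
have /rV0Pn[i vi] := v0.
apply/hasP; exists i; rewrite ?mem_index_enum//= lt0r F0 andbT.
apply: contra vi; rewrite /F; case: (v 0 i) => x y /=.
by rewrite paddr_eq0 ?sqr_ge0// !sqrf_eq0 eq_complex.
Qed.

End PositiveDeterminant.

(** * Iterated integrals *)

Section IteratedIntegral.
Variable R : realType.

(* The integral of a nonnegative function is a supremum over the simple
   functions below it, so that measurability plays no role. *)
Lemma ge0_le_integral_nonmeasurable d (T : measurableType d)
    (mu : {measure set T -> \bar R}) (f g : T -> \bar R) :
  (forall x, 0 <= f x)%E -> (forall x, f x <= g x)%E ->
  (\int[mu]_x f x <= \int[mu]_x g x)%E.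
Proof.
move=> f0 fg; have g0 x : (0 <= g x)%E by exact: le_trans (fg x).
rewrite !ge0_integralTE//; apply: ereal_sup_le => _ /= [h hf <-].
by exists h => // x; exact: le_trans (hf x) (fg x).
Qed.

Lemma integral_rV_ge0 n (f : 'rV[R]_n -> \bar R) :
  (forall p, 0 <= f p)%E -> (0 <= integral_rV f)%E.
Proof.
elim: n f => [|n IH] f f0 /=; first exact: f0.
by apply: integral_ge0 => x _; apply: IH.
Qed.

(** At each coordinate the inner integral dominates a constant times the indicator of one side of
    the box, by induction; monotonicity of the outer integral concludes. *)
Lemma integral_rV_ge_box n (f : 'rV[R]_n -> \bar R) (lo len : 'rV[R]_n) (c : R) :
  0 <= c -> (forall j, 0 <= len 0 j) -> (forall p, 0 <= f p)%E ->
  (forall p : 'rV[R]_n, (forall j, lo 0 j <= p 0 j <= lo 0 j + len 0 j) -> (c%:E <= f p)%E) ->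
  ((c * \prod_j len 0 j)%:E <= integral_rV f)%E.
Proof.
elim: n f lo len => [|n IH] f lo len c0 len0 f0 cf.
  by rewrite big_ord0 mulr1; apply: cf => -[].
pose a := lo 0 0; pose b := lo 0 0 + len 0 0.
pose C := c * \prod_j len 0 (lift 0 j).
have C0 : 0 <= C by rewrite mulr_ge0// prodr_ge0.
have ab : a <= b by rewrite lerDl.
have mab : lebesgue_measure (`[a, b] : set R) = (b - a)%:E.
  rewrite lebesgue_measure_itv/= lte_fin; case: ltP => // ba.
  by rewrite (_ : b = a) ?subrr//; apply/eqP; rewrite eq_le ba.
have -> : ((c * \prod_j len 0 j)%:E = \int[lebesgue_measure]_x (C%:E * (\1_(`[a, b]) x)%:E))%E.
  rewrite ge0_integralZl//; last exact/measurable_EFinP/measurable_indic.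
  rewrite integral_indic// setIT; apply: etrans (congr1 (fun z => C%:E * z)%E (esym mab)).
  by rewrite -EFinM big_ord_recl mulrCA [b]addrC addrK mulrC -mulrA.
apply: ge0_le_integral_nonmeasurable => x.
  by rewrite mule_ge0// lee_fin.
rewrite indicE; have [xab|xab] := boolP (x \in `[a, b]%classic); last first.
  by rewrite mule0; exact: integral_rV_ge0.
rewrite mule1; have := IH (fun y => f (row_mx (const_mx x : 'rV[R]_1) y))
  (\row_j lo 0 (lift 0 j)) (\row_j len 0 (lift 0 j)) c0.
rewrite /C; under eq_bigr do rewrite mxE.
apply => // [j|p lop]; first by rewrite mxE.
apply: cf => j; move: xab; rewrite inE/= in_itv/= => xab.
have [j' ->|->] := unliftP 0 j.
  have -> : row_mx (const_mx x : 'rV[R]_1) p 0 (lift 0 j') = p 0 j'.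
    by rewrite -rshift1 row_mxEr.
  by have := lop j'; rewrite !mxE.
suff -> : row_mx (const_mx x : 'rV[R]_1) p 0 0 = x by [].
have := row_mxEl (const_mx x : 'rV[R]_1) p 0 0; rewrite [const_mx x 0 0]mxE.
by apply: etrans; congr (row_mx _ _ _ _); exact: val_inj.
Qed.

End IteratedIntegral.

(** * The open orbit *)

Section ComplexExponential.
Variable R : realType.

(* The complex number of logarithm r / 2 + i t. *)
Definition cexp (r t : R) : R[i] := (expR (r / 2))%:C * (cos t +i* sin t).

Lemma expR_half_sqr (x : R) : expR (x / 2) ^+ 2 = expR x.
Proof. by rewrite -expRM_natl mulrC divfK ?pnatr_eq0. Qed.

Lemma cexpD r t r' t' : cexp (r + r') (t + t') = cexp r t * cexp r' t'.
Proof.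
rewrite /cexp mulrDl expRD cosD sinD; simpc.
by congr (_ +i* _); ring.
Qed.

Lemma cexp0 : cexp 0 0 = 1.
Proof. by rewrite /cexp mul0r expR0 cos0 sin0 mulr1. Qed.

Lemma normc_cexp r t : normc (cexp r t) = expR (r / 2).
Proof.
rewrite /cexp normcM /= expr0n addr0 cos2Dsin2 sqrtr1 mulr1 sqrtr_sqr.
by rewrite ger0_norm// expR_ge0.
Qed.

Lemma cexp_neq0 r t : cexp r t != 0.
Proof.
apply/eqP => E; have := normc_cexp r t.
by rewrite E normc0 => /esym/eqP; rewrite gt_eqF// expR_gt0.
Qed.

Lemma cexpN r t : cexp (- r) (- t) = (cexp r t)^-1.
Proof.
apply: (mulfI (cexp_neq0 r t)).
by rewrite -cexpD !subrr cexp0 mulfV// cexp_neq0.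
Qed.

Lemma cexpMz r t (n : int) : cexp (n%:~R * r) (n%:~R * t) = cexp r t ^ n.
Proof.
have cexpMn k : cexp (k%:R * r) (k%:R * t) = cexp r t ^+ k.
  elim: k => [|k IH]; first by rewrite !mul0r cexp0.
  by rewrite exprS -IH -cexpD -natr1 !mulrDl !mul1r ![_ + r]addrC ![_ + t]addrC.
case: n => k; first exact: cexpMn.
by rewrite NegzE mulrNz !mulNr cexpN cexpMn.
Qed.

(** The angle is acos of the real part of z / |z|, with the sign of the imaginary part. *)
Lemma cexp_surj (z : R[i]) : z != 0 -> exists t, z = cexp (2 * ln (normc z)) t.
Proof.
move=> z0; have nz : 0 < normc z.
  rewrite lt0r; apply/andP; split; last by case: z {z0} => a b; rewrite sqrtr_ge0.
  by apply: contra z0 => /eqP/eq0_normc ->.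
pose u := z * ((normc z)^-1)%:C.
have -> : z = (normc z)%:C * u.
  by rewrite mulrCA -rmorphM mulfV ?gt_eqF//= rmorph1 mulr1.
have nu : normc u = 1.
  by rewrite normcM /= expr0n addr0 sqrtr_sqr ger0_norm ?invr_ge0 ?mulfV ?ltW ?gt_eqF.
have E : normc ((normc z)%:C * u) = normc z.
  by rewrite normcM nu mulr1 /= expr0n addr0 sqrtr_sqr ger0_norm// ltW.
rewrite E /cexp [2 * _]mulrC mulfK ?pnatr_eq0// lnK ?posrE//.
move: nu; case: u {E} => a b /= ab.
have {}ab : a ^+ 2 + b ^+ 2 = 1.
  by rewrite -[LHS]sqr_sqrtr ?ab ?expr1n// addr_ge0 ?sqr_ge0.
have a1 : -1 <= a <= 1.
  by rewrite -ler_norml -(@ler_pXn2r _ 2) ?nnegrE// expr1n real_normK ?num_real// -ab lerDl sqr_ge0.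
have [b0|b0] := leP 0 b.
  by exists (acos a); rewrite acosK// sin_acos// -ab addrC addKr sqrtr_sqr ger0_norm.
exists (- acos a).
by rewrite cosN sinN acosK// sin_acos// -ab addrC addKr sqrtr_sqr ltr0_norm// opprK.
Qed.

End ComplexExponential.

Section Orbit.
Variables (R : realType) (m : nat).

Lemma intrvM n p q (A : 'M[int]_(n, p)) (B : 'M[int]_(p, q)) :
  intrv R (A *m B) = intrv R A *m intrv R B.
Proof. exact: map_mxM. Qed.

Lemma dotrvE (x y : 'rV[R]_m) : dotrv x y = (x *m y^T) 0 0.
Proof. by rewrite mxE; apply: eq_bigr => j _; rewrite mxE. Qed.

Lemma dotrvC (x y : 'rV[R]_m) : dotrv x y = dotrv y x.
Proof. by apply: eq_bigr => j _; rewrite mulrC. Qed.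

Lemma dotrvDl (x y z : 'rV[R]_m) : dotrv (x + y) z = dotrv x z + dotrv y z.
Proof. by rewrite -big_split; apply: eq_bigr => j _; rewrite mxE mulrDl. Qed.

Lemma dotrvZl c (x z : 'rV[R]_m) : dotrv (c *: x) z = c * dotrv x z.
Proof. by rewrite mulr_sumr; apply: eq_bigr => j _; rewrite mxE mulrA. Qed.

Lemma dotrvDr (x y z : 'rV[R]_m) : dotrv z (x + y) = dotrv z x + dotrv z y.
Proof. by rewrite ![dotrv z _]dotrvC dotrvDl. Qed.

Lemma dotrvZr c (x z : 'rV[R]_m) : dotrv z (c *: x) = c * dotrv z x.
Proof. by rewrite ![dotrv z _]dotrvC dotrvZl. Qed.

Lemma dotrv_row (A : 'M[int]_m) (x : 'rV[R]_m) j :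
  dotrv (intrv R (row j A)) x = (x *m (intrv R A)^T) 0 j.
Proof. by rewrite mxE; apply: eq_bigr => l _; rewrite !mxE mulrC. Qed.

Lemma dotrv_mul (a : 'rV[int]_m) (A : 'M[int]_m) (x : 'rV[R]_m) :
  dotrv (intrv R (a *m A)) x = dotrv (intrv R a) (x *m (intrv R A)^T).
Proof. by rewrite !dotrvE intrvM trmx_mul trmxK mulmxA. Qed.

Lemma expzE (rho theta : 'rV[R]_m) j : expz rho theta 0 j = cexp (rho 0 j) (theta 0 j).
Proof. by rewrite mxE. Qed.

Lemma monomial_expz (rho theta : 'rV[R]_m) (a : 'rV[int]_m) :
  monomial (expz rho theta) a = cexp (dotrv (intrv R a) rho) (dotrv (intrv R a) theta).
Proof.
rewrite /monomial /dotrv.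
under eq_bigr do rewrite expzE -cexpMz.
under [X in cexp X _]eq_bigr do rewrite mxE.
under [X in cexp _ X]eq_bigr do rewrite mxE.
apply: (big_ind3 (fun z r t => z = cexp r t)) => [|_ r t _ r' t' -> ->|//].
  by rewrite cexp0.
by rewrite cexpD.
Qed.

Variable P : delzant R m.
Implicit Types (i : chart P) (rho theta : 'rV[R]_m).

(** Its transpose takes rho = log |z|^2 to the logarithmic coordinates xi = log |w|^2 of the chart:
    xi = rho E^T. *)
Definition realedge i : 'M[R]_m := intrv R (edge P i).

Lemma realedge_unit i : realedge i \in unitmx.
Proof.
rewrite unitmxE /realedge det_map_mx; apply: rmorph_unit.
by rewrite -unitmxE edge_unit.
Qed.

Lemma det_realedge_sqr i : \det (realedge i) ^+ 2 = 1.
Proof.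
rewrite det_map_mx -rmorphXn /=.
have : \det (edge P i) \is a GRing.unit by rewrite -unitmxE edge_unit.
by rewrite [_ \is a _]/(_ || _) => /pred2P[] ->.
Qed.

Lemma orbit_coord_expz i rho theta :
  orbit_coord i (expz rho theta) = expz (rho *m (realedge i)^T) (theta *m (realedge i)^T).
Proof. by apply/rowP => j; rewrite mxE monomial_expz !dotrv_row expzE. Qed.

Lemma torus_act_orbit i rho theta :
  torus_act theta i (orbit_coord i (expz rho 0)) = orbit_coord i (expz rho theta).
Proof.
apply/rowP => j; rewrite mxE !orbit_coord_expz !expzE -cexpD !mul0mx.
by rewrite mxE add0r mxE addr0.
Qed.

Lemma glued_orbit i i' rho :
  glued i (orbit_coord i (expz rho 0)) i' (orbit_coord i' (expz rho 0)).
Proof.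
split=> j; first by rewrite orbit_coord_expz expzE cexp_neq0.
rewrite !orbit_coord_expz monomial_expz expzE !mul0mx !dotrv_row; congr cexp.
  by rewrite -mulmxA -trmx_mul -intrvM mulmxKV// edge_unit.
by rewrite mul0mx.
Qed.

Lemma dotrv_chart_exp k i (a : 'rV[int]_m) rho :
  dotrv (intrv R (chart_exp k i a)) (rho *m (realedge i)^T) =
  dotrv (intrv R a) rho - k%:R * dotrv (intrv R (vert P i)) rho.
Proof.
rewrite -dotrv_mul mulmxKV ?edge_unit//.
have -> : intrv R (a - vert P i *+ k) = intrv R a + (-1) *: (k%:R *: intrv R (vert P i)).
  by apply/rowP => j; rewrite !mxE mulmxnE rmorphB rmorphMn /= mulN1r mulr_natl.
by rewrite dotrvDl !dotrvZl mulN1r.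
Qed.

Lemma orbit_surj i (w : 'rV[R[i]]_m) : (forall j, w 0 j != 0) ->
  exists theta, w = orbit_coord i
     (expz ((\row_j (2 * ln (normc (w 0 j)))) *m (invmx (realedge i))^T) theta).
Proof.
move=> w0; have [t tE] := choice (fun j => cexp_surj (w0 j)).
exists ((\row_j t j) *m (invmx (realedge i))^T).
rewrite orbit_coord_expz -!mulmxA -!trmx_mul mulmxV ?realedge_unit// trmx1 !mulmx1.
by apply/rowP => j; rewrite expzE !mxE -tE.
Qed.

Section Metric.
Variables (h : metric P) (hT : toric_metric h).

(** Torus invariance removes theta, and gluing carries the value to the chart [ord0], through which
    [open_potential] is defined. *)
Lemma metric_orbit i rho theta : h i (orbit_coord i (expz rho theta)) =
  expR (dotrv (intrv R (vert P i)) rho - open_potential h rho).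
Proof.
rewrite -torus_act_orbit (metric_inv hT) (metric_glued hT (glued_orbit ord0 i rho)).
rewrite orbit_coord_expz mul0mx monomial_expz normc_cexp dotrv_chart_exp.
rewrite expR_half_sqr mul1r.
have H0 := metric_gt0 hT ord0 (expz (rho *m (realedge ord0)^T) 0).
rewrite -[X in _ * X]lnK ?posrE// -expRD; congr expR.
by rewrite /open_potential orbit_coord_expz mul0mx opprB -addrA; congr (_ + _); rewrite addrC.
Qed.

Lemma sec_norm2_orbit k a i rho theta :
  sec_norm2 h k a i (orbit_coord i (expz rho theta)) =
  expR (dotrv (intrv R a) rho - k%:R * open_potential h rho).
Proof.
rewrite /sec_norm2 metric_orbit orbit_coord_expz monomial_expz normc_cexp dotrv_chart_exp.
rewrite expR_half_sqr -expRM_natl -expRD; congr expR.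
by rewrite mulrBr addrA subrK.
Qed.

End Metric.

Lemma covering rho : exists i, forall j, (rho *m (realedge i)^T) 0 j <= 0.
Proof.
have [i _ imax] := @arg_maxP _ _ _ (ord0 : chart P) predT
  (fun i => dotrv (intrv R (vert P i)) rho) isT.
(* i maximizes <v_i, rho>, and the edges at v_i point into the polytope. *)
exists i => j; pose x : 'rV[R]_m := row j (realedge i).
have [s s0 [c [c0 c1 E]]] : exists2 s : R, 0 < s &
    polytope P (intrv R (vert P i) + s *: x).
  apply/edge_cone; exists (delta_mx 0 j); last by rewrite -rowE.
  by move=> l; rewrite mxE; case: (_ && _).
have := congr1 (fun y => dotrv y rho) E; rewrite dotrvDl dotrvZl => {}E.
have -> : (rho *m (realedge i)^T) 0 j = dotrv x rho.
  by rewrite dotrvC mxE; apply: eq_bigr => l _; rewrite !mxE.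
suff : dotrv (\sum_l c l *: intrv R (vert P l)) rho <= dotrv (intrv R (vert P i)) rho.
  by rewrite -E gerDl pmulr_rle0.
have -> : dotrv (\sum_l c l *: intrv R (vert P l)) rho =
          \sum_l c l * dotrv (intrv R (vert P l)) rho.
  apply: (big_ind2 (fun y d => dotrv y rho = d)) => [|y _ y' _ <- <-|l _].
  - by rewrite /dotrv big1// => l _; rewrite mxE mul0r.
  - by rewrite dotrvDl.
  - by rewrite dotrvZl.
rewrite -[leRHS]mul1r -c1 mulr_suml ler_sum// => l _.
by rewrite ler_wpM2l//; exact: imax.
Qed.

(** a / k - v_i lies in the tangent cone at v_i, which the edges generate; the exponents are k times
    its coordinates in the basis of edges. *)
Lemma chart_exp_ge0 k i a : lattice_points P k a -> forall j, 0 <= chart_exp k i a 0 j.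
Proof.
move=> [x Px ax] j; rewrite -(ler0z R).
have [c c0 E] : exists2 c : 'rV[R]_m, forall j, 0 <= c 0 j &
    x - intrv R (vert P i) = c *m realedge i.
  by apply/edge_cone; exists 1 => //; rewrite scale1r addrC subrK.
have -> : (chart_exp k i a 0 j)%:~R = (k%:R *: c) 0 j.
  have -> : k%:R *: c = intrv R (chart_exp k i a); last by rewrite [RHS]mxE.
  apply: (can_inj (mulmxK (realedge_unit i))).
  rewrite -scalemxAl -E -intrvM mulmxKV ?edge_unit// scalerBr -ax.
  by apply/rowP => l; rewrite !mxE mulmxnE rmorphB rmorphMn /= mulr_natl.
by rewrite mxE mulr_ge0.
Qed.

End Orbit.

(** * Potentials and uniform bounds *)

Section Compactness.
Variable R : realType.

Lemma compact_lower_bound (T : topologicalType) (K : set T) (g : T -> R) :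
  compact K -> (forall v, K v -> continuous_at v g) -> (forall v, K v -> 0 < g v) ->
  exists2 c, 0 < c & forall v, K v -> c <= g v.
Proof.
move=> cK cg g0; have [->|/set0P K0] := eqVneq K set0; first by exists 1.
have cg' : {within K, continuous g}.
  by apply: continuous_in_subspaceT => v; rewrite inE; exact: cg.
have [v vK vmin] := compact_EVT_min K0 cK cg'.
rewrite inE in vK; exists (g v); first exact: g0.
by move=> u uK; apply: vmin; rewrite inE.
Qed.

Lemma compact_upper_bound (T : topologicalType) (K : set T) (g : T -> R) :
  compact K -> (forall v, K v -> continuous_at v g) ->
  exists C, forall v, K v -> `|g v| <= C.
Proof.
move=> cK cg; have [->|/set0P K0] := eqVneq K set0; first by exists 0.
have cg' : {within K, continuous (fun v => `|g v|)}.
  apply: continuous_in_subspaceT => v; rewrite inE => Kv.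
  by apply: for_continuous_comp (cg v Kv) _; exact: norm_continuous.
have [v _ vmax] := compact_EVT_max K0 cK cg'.
by exists `|g v| => u uK; apply: vmax; rewrite inE.
Qed.

(** Constants are found chart by chart; the charts being finite in number, the smallest one serves
    them all. *)
Lemma uniform_pos (I : finType) (Q : I -> R -> Prop) :
  (forall i c c', 0 < c' <= c -> Q i c -> Q i c') ->
  (forall i, exists2 c, 0 < c & Q i c) -> exists2 c, 0 < c & forall i, Q i c.
Proof.
move=> Qle Qex.
have [f fQ] := choice (fun i => let: ex_intro2 c c0 q := Qex i in
  ex_intro (fun c => 0 < c /\ Q i c) c (conj c0 q)).
exists (\big[Num.min/1]_i f i).
  by apply: lt_bigmin => // i _; exact: (fQ i).1.
move=> i; apply: Qle (fQ i).2; apply/andP; split; last exact: bigmin_le.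
by apply: lt_bigmin => // l _; exact: (fQ l).1.
Qed.

Lemma uniform_bound (I : finType) (Q : I -> R -> Prop) :
  (forall i C C', C <= C' -> Q i C -> Q i C') ->
  (forall i, exists C, Q i C) -> exists2 C, 0 < C & forall i, Q i C.
Proof.
move=> Qle /choice[f fQ]; exists (\big[Num.max/1]_i f i).
  by apply: lt_le_trans (bigmax_ge_id _ _ _ _); exact: ltr01.
by move=> i; apply: Qle (fQ i); exact: le_bigmax.
Qed.

Lemma for_continuous_det (T : topologicalType) n (A : T -> 'M[R]_n) x :
  (forall j l, continuous_at x (fun y => A y j l)) -> continuous_at x (fun y => \det (A y)).
Proof.
move=> cA; apply: for_continuous_sum => s _.
apply: for_continuousM; first exact: cst_continuous.
by apply: for_continuous_prod => j _.
Qed.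

End Compactness.

(** * Potentials of a toric metric in the charts *)

Section ToricPotentials.
Variables (R : realType) (m : nat) (P : delzant R m).

(* - log |e_i|^2_h *)
Definition chart_potential (h : metric P) (i : chart P) (p : 'rV[R]_(m + m)) : R :=
  - ln (h i (toC p)).

(* [chart_potential] in terms of xi_j = log |w_j|^2 *)
Definition log_potential (h : metric P) (i : chart P) (xi : 'rV[R]_m) : R :=
  chart_potential h i (expemb xi).

Lemma continuous_expemb : continuous (@expemb R m).
Proof.
move=> xi; apply: continuous_rV => a; case: (split_ordP a) => j ->.
  under eq_fun do rewrite expembE_l.
  apply: (@for_continuous_comp _ _ _ (fun xi : 'rV[R]_m => xi 0 j / 2) expR);
    last exact: continuous_expR.
  by apply: for_continuousM; [exact: coord_continuous|exact: cst_continuous].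
by under eq_fun do rewrite expembE_r; exact: cst_continuous.
Qed.

Lemma is_derive_expR_half (x : 'rV[R]_m) l j :
  is_derive x (delta_mx 0 l) (fun xi => expR (xi 0 j / 2)) ((l == j)%:R / 2 * expR (x 0 j / 2)).
Proof.
have d := is_derive_coord x l j.
have d2 : is_derive x (delta_mx 0 l) (fun xi : 'rV[R]_m => xi 0 j / 2) ((l == j)%:R / 2).
  have := @is_deriveZ _ _ _ (fun xi : 'rV[R]_m => xi 0 j) 2^-1 _ _ _ d.
  rewrite [_ *: (_ == _)%:R]mulrC.
  by congr (is_derive _ _ _ _); apply/funext => y; rewrite /= [_ *: _]mulrC.
exact: (is_derive_comp1 d2 (is_derive_expR (x 0 j / 2))).
Qed.

Lemma Cn_expR_half N j : Cn N (fun xi : 'rV[R]_m => expR (xi 0 j / 2)).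
Proof.
have C : continuous (fun xi : 'rV[R]_m => expR (xi 0 j / 2)).
  move=> xi; apply: (@for_continuous_comp _ _ _ (fun xi : 'rV[R]_m => xi 0 j / 2) expR);
    last exact: continuous_expR.
  by apply: for_continuousM; [exact: coord_continuous|exact: cst_continuous].
elim: N => [|N IH]; first by split.
apply: (@CnS _ _ _ _ (fun l xi => (l == j)%:R / 2 * expR (xi 0 j / 2))) => //.
  by move=> l x; exact: is_derive_expR_half.
by move=> l; apply: CnM => //; exact: Cn_cst.
Qed.

Lemma Cn_expemb N (f : 'rV[R]_(m + m) -> R) : Cn N f -> Cn N (fun xi => f (expemb xi)).
Proof.
have C M (g : 'rV[R]_(m + m) -> R) : Cn M g -> continuous (fun xi => g (expemb xi)).
  move=> gM x; apply: for_continuous_comp; first exact: continuous_expemb.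
  exact: (Cn_continuous gM).
elim: N f => [|N IH] f fN; first by split=> //; exact: C fN.
apply: (@CnS _ _ _ _ (fun j xi => expR (xi 0 j / 2) / 2 *
    'D_(delta_mx 0 (lshift m j)) f (expemb xi))) => //.
- exact: C fN.
- move=> j x; apply: is_derive_expemb; apply: derivableP.
  exact: (Cn_derivable _ _ fN).
- move=> j; apply: CnM; first by apply: CnM; [exact: Cn_expR_half|exact: Cn_cst].
  exact/(IH (fun p => 'D_(delta_mx 0 (lshift m j)) f p))/Cn_derive.
Qed.

Lemma toC_expemb (xi : 'rV[R]_m) : toC (expemb xi) = expz xi 0.
Proof.
apply/rowP => j; rewrite !mxE; case: split_ordP => k; last by move/eqP; rewrite eq_lrshift.
move=> /lshift_inj <-; case: split_ordP => l; first by move/eqP; rewrite eq_rlshift.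
by move=> /rshift_inj <-; rewrite !mxE cos0 sin0; simpc.
Qed.

Lemma normc_toC (p : 'rV[R]_(m + m)) j : normc (toC p 0 j) ^+ 2 = abs2 j p.
Proof. by rewrite mxE /= sqr_sqrtr// addr_ge0 ?sqr_ge0. Qed.

Lemma toC_orbit (i : chart P) (p : 'rV[R]_(m + m)) : (forall j, 0 < abs2 j p) ->
  exists theta, toC p = orbit_coord i (expz (logabs2 p *m (invmx (realedge i))^T) theta)
  :> 'rV[R[i]]_m.
Proof.
move=> p0; have [j|theta E] := @orbit_surj R m P i (toC p).
  apply/eqP => E; have := p0 j; rewrite -normc_toC E normc0 expr0n ltxx//.
suff L : (\row_j (2 * ln (normc (toC p 0 j)))) = logabs2 p by exists theta; rewrite -L.
apply/rowP => j; rewrite [LHS]mxE [RHS]mxE -normc_toC.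
have nz : 0 < normc (toC p 0 j).
  rewrite lt0r -sqrf_eq0 normc_toC gt_eqF//=.
  by case: (toC p 0 j) => x y /=; rewrite sqrtr_ge0.
by rewrite lnXn// mulr_natl.
Qed.

Variables (h : metric P) (hT : toric_metric h).

Lemma Cn_chart_potential N i : Cn N (chart_potential h i).
Proof.
by apply/CnN/Cn_ln => [p|]; [exact: (metric_gt0 hT)|exact: (metric_smooth hT)].
Qed.

Lemma Cn_log_potential N i : Cn N (log_potential h i).
Proof. exact/Cn_expemb/Cn_chart_potential. Qed.

(** e_i = z^(v_i) e, so the two potentials differ by a function linear in rho, which Hessians do not
    see. *)
Lemma open_potentialE i rho :
  open_potential h rho = log_potential h i (rho *m (realedge i)^T) + dotrv (intrv R (vert P i)) rho.
Proof.
rewrite /log_potential /chart_potential toC_expemb.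
rewrite -[X in expz _ X](mul0mx _ (realedge i)^T) -orbit_coord_expz metric_orbit// expRK.
by rewrite opprB subrK.
Qed.

Lemma log_potentialE i xi :
  log_potential h i xi = open_potential h (xi *m (invmx (realedge i))^T) -
    dotrv (intrv R (vert P i)) (xi *m (invmx (realedge i))^T).
Proof.
rewrite (open_potentialE i) addrK -mulmxA -trmx_mul mulmxV ?realedge_unit//.
by rewrite trmx1 mulmx1.
Qed.

(** By torus invariance - log |e_i|^2 depends on the moduli only. *)
Lemma chart_potential_logabs2 i p : (forall j, 0 < abs2 j p) ->
  chart_potential h i p = log_potential h i (logabs2 p).
Proof.
move=> p0; have [theta E] := toC_orbit i p0.
by rewrite /chart_potential E metric_orbit// expRK log_potentialE opprB.
Qed.

Lemma Cn_open_potential N : Cn N (open_potential h).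
Proof.
have -> : open_potential h = (fun rho =>
   log_potential h ord0 (rho *m (realedge (ord0 : chart P))^T) +
   dotrv (intrv R (vert P ord0)) rho).
  by apply/funext => rho; exact: open_potentialE.
by apply: CnD; [exact/Cn_mulmxr/Cn_log_potential|exact: Cn_dotrv].
Qed.

Lemma hess_open_potential i rho : hess (open_potential h) rho =
  (realedge i)^T *m hess (log_potential h i) (rho *m (realedge i)^T) *m realedge i.
Proof.
rewrite -[X in _ *m X]trmxK -hess_mulmxr; last exact: Cn_log_potential.
apply/matrixP => j l; rewrite [LHS]mxE [RHS]mxE.
set f := fun rho => log_potential h i (rho *m _).
have f2 : Cn 2 f by exact/Cn_mulmxr/Cn_log_potential.
have -> : (fun y => 'D_(delta_mx 0 l) (open_potential h) y) =
    (fun y => 'D_(delta_mx 0 l) f y) + cst (intrv R (vert P i) 0 l).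
  apply/funext => y.
  have -> : open_potential h = f + (fun rho => dotrv (intrv R (vert P i)) rho).
    by apply/funext => r; exact: open_potentialE.
  have [d1 d2] := @is_derive_dotrv R m (intrv R (vert P i)) y l.
  by rewrite deriveD ?d2//; exact: (@Cn_derivable _ _ 1 f).
rewrite deriveD ?derive_cst ?addr0//.
exact/(@Cn_derivable _ _ 0)/Cn_derive.
Qed.

(** Both sides equal det Hess psi, as edge matrices have determinant 1 or -1. This carries the
    density from the chart of integration to one where the coordinates are bounded. *)
Lemma det_hess_log_potential i i' rho :
  \det (hess (log_potential h i) (rho *m (realedge i)^T)) =
  \det (hess (log_potential h i') (rho *m (realedge i')^T)).
Proof.
have D k : \det (hess (log_potential h k) (rho *m (realedge k)^T)) =
    \det (hess (open_potential h) rho).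
  by rewrite (hess_open_potential k) !det_mulmx det_tr mulrAC -expr2 det_realedge_sqr mul1r.
exact (etrans (D i) (esym (D i'))).
Qed.

Lemma volume_density_ge0 i p : 0 <= volume_density h i p.
Proof.
rewrite /volume_density divr_ge0 ?exprn_ge0 ?pi_ge0//.
by apply/ltW/Re_det_posdef => c c0; exact: (metric_pos hT i p c0).
Qed.

Lemma volume_density_logabs2 i p : (forall j, 0 < abs2 j p) ->
  volume_density h i p =
  \det (hess (log_potential h i) (logabs2 p)) * (\prod_j (abs2 j p)^-1) / pi ^+ m.
Proof.
move=> p0; rewrite /volume_density (@det_complex_hessian_logabs2 _ _ (log_potential h i))//.
  exact: Cn_log_potential.
by move=> q q0; exact: (chart_potential_logabs2 i q0).
Qed.

Lemma det_hess_log_potential_Re i xi :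
  \det (hess (log_potential h i) xi) =
  (\prod_j expR (xi 0 j)) * \det (map_mx (@complex.Re R) (curvature h i (expemb xi))).
Proof.
have := @Re_complex_hessian_expemb R m (log_potential h i) (chart_potential h i) xi.
by apply; [exact: Cn_log_potential|exact: chart_potential_logabs2].
Qed.

End ToricPotentials.

Section NegLn.
Variables (R : realType) (n : nat) (H : 'rV[R]_n -> R).
Hypothesis H0 : forall p, 0 < H p.

Lemma is_derive_neg_ln p a : Cn 1 H ->
  is_derive p (delta_mx 0 a) (fun q => - ln (H q)) (- ('D_(delta_mx 0 a) H p * (H p)^-1)).
Proof.
move=> H1.
have d := is_derive_ln_comp (H0 p) (derivableP (Cn_derivable p (delta_mx 0 a) H1)).
exact: (is_deriveN d).
Qed.

Lemma derive_neg_ln p a : Cn 1 H ->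
  'D_(delta_mx 0 a) (fun q => - ln (H q)) p = - ('D_(delta_mx 0 a) H p * (H p)^-1).
Proof. by move=> /(is_derive_neg_ln p a)[]. Qed.

Lemma derive2_neg_ln p a b : Cn 2 H ->
  'D_(delta_mx 0 a) (fun q => 'D_(delta_mx 0 b) (fun q => - ln (H q)) q) p =
  'D_(delta_mx 0 b) H p * 'D_(delta_mx 0 a) H p * ((H p)^-1) ^+ 2
  - 'D_(delta_mx 0 a) (fun q => 'D_(delta_mx 0 b) H q) p * (H p)^-1.
Proof.
move=> H2; have H1 := CnW H2.
have -> : (fun q => 'D_(delta_mx 0 b) (fun q => - ln (H q)) q) =
          (fun q => - ('D_(delta_mx 0 b) H q * (H q)^-1)).
  by apply/funext => q; exact: derive_neg_ln.
have d1 := derivableP (Cn_derivable p (delta_mx 0 a) (Cn_derive b H2)).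
have d2 : is_derive p (delta_mx 0 a) (fun q => (H q)^-1)
    (- (H p) ^- 2 * 'D_(delta_mx 0 a) H p).
  have dH := Cn_derivable p (delta_mx 0 a) H1.
  have H0' : H p != 0 by rewrite gt_eqF.
  by apply: DeriveDef; [exact: derivableV|rewrite deriveV].
have [_ ->] := is_deriveN (is_deriveM d1 d2).
rewrite /GRing.scale/= exprVn; ring.
Qed.

End NegLn.

(** * Bounds uniform in time, by compactness *)

Section UniformBounds.
Variables (R : realType) (m : nat) (P : delzant R m) (h : R -> metric P).
Hypothesis hT : forall t, 0 <= t <= 1 -> toric_metric (h t).
Hypothesis hS : smooth_path h.

Definition time_box_side (B : R) (j : 'I_(1 + (m + m))) : set R :=
  if fintype.split j is inl _ then `[0, 1]%classic else `[- B, B]%classic.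

Definition time_box (B : R) : set 'rV[R]_(1 + (m + m)) :=
  [set v | forall j, time_box_side B j (v ord0 j)].

Lemma time_box_compact B : compact (time_box B).
Proof.
apply: (@rV_compact R _ (time_box_side B)) => j.
by rewrite /time_box_side; case: (fintype.split j) => _; exact: segment_compact.
Qed.

Lemma time_boxP B v : time_box B v <-> exists t p,
  [/\ v = row_mx (const_mx t : 'rV[R]_1) p, 0 <= t <= 1 & forall a, `|p 0 a| <= B].
Proof.
split=> [vB|[t [p [-> t01 pB]]] j]; last first.
  rewrite /time_box_side.
  case: split_ordP => k ->; first by rewrite row_mxEl mxE /= in_itv.
  by rewrite row_mxEr /= in_itv/= -ler_norml.
exists (v 0 (lshift _ 0)), (rsubmx v); split.
- rewrite -[LHS]hsubmxK; congr row_mx; apply/rowP => j; rewrite !mxE ord1//.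
- have := vB (lshift _ 0); rewrite /time_box_side.
  case: split_ordP => k; last by move/eqP; rewrite eq_lrshift.
  by move=> _; rewrite /= in_itv.
- move=> a; have := vB (rshift _ a); rewrite /time_box_side.
  case: split_ordP => k; first by move/eqP; rewrite eq_rlshift.
  by move=> _; rewrite /= in_itv/= mxE ler_norml.
Qed.

Lemma row_mx_shift (t : R) (p : 'rV[R]_(m + m)) a (s : R) :
  row_mx (const_mx t : 'rV[R]_1) (s *: delta_mx 0 a + p) =
  s *: delta_mx 0 (rshift 1 a) + row_mx (const_mx t : 'rV[R]_1) p.
Proof.
apply/rowP => j; rewrite !mxE eqxx/=; case: split_ordP => k -> /=.
  by rewrite eq_lrshift mulr0 add0r.
by rewrite !mxE eqxx eq_rshift.
Qed.

Lemma derive_row_mx (F : 'rV[R]_(1 + (m + m)) -> R) t a (p : 'rV[R]_(m + m)) :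
  'D_(delta_mx 0 a) (fun q => F (row_mx (const_mx t : 'rV[R]_1) q)) p =
  'D_(delta_mx 0 (rshift 1 a)) F (row_mx (const_mx t : 'rV[R]_1) p).
Proof.
pose T (q : 'rV[R]_(m + m)) := row_mx (const_mx t : 'rV[R]_1) q.
have E : (fun s : R => s^-1 *: (F (T (s *: delta_mx 0 a + p)) - F (T p))) =
         (fun s : R => s^-1 *: (F (s *: delta_mx 0 (rshift 1 a) + T p) - F (T p))).
  by apply/funext => s; rewrite /T row_mx_shift.
by rewrite /T in E; rewrite /derive/= E.
Qed.

Lemma derive_chart_potential (g : metric P) (gT : toric_metric g) i (p : 'rV[R]_(m + m)) a :
  let H q := g i (toC q) in
  'D_(delta_mx 0 a) (chart_potential g i) p = - ('D_(delta_mx 0 a) H p * (H p)^-1).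
Proof.
move=> H; apply: derive_neg_ln; first by move=> q; exact: (metric_gt0 gT).
exact: @metric_smooth _ _ _ _ gT i 1.
Qed.

Lemma derive2_chart_potential (g : metric P) (gT : toric_metric g) i (p : 'rV[R]_(m + m)) a b :
  let H q := g i (toC q) in
  'D_(delta_mx 0 a) (fun q => 'D_(delta_mx 0 b) (chart_potential g i) q) p =
  'D_(delta_mx 0 b) H p * 'D_(delta_mx 0 a) H p * ((H p)^-1) ^+ 2
  - 'D_(delta_mx 0 a) (fun q => 'D_(delta_mx 0 b) H q) p * (H p)^-1.
Proof.
move=> H; apply: derive2_neg_ln; first by move=> q; exact: (metric_gt0 gT).
exact: @metric_smooth _ _ _ _ gT i 2.
Qed.

(** On real vectors, the real part of the curvature form is the quadratic form of the real part of
    the matrix. *)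
Lemma det_Re_curvature_gt0 (g : metric P) (gT : toric_metric g) i p :
  0 < \det (map_mx (@complex.Re R) (curvature g i p)).
Proof.
apply: det_posdef => c c0.
have cC0 : map_mx (real_complex R) c != 0 by rewrite map_mx_eq0.
have := metric_pos gT i p cC0; rewrite ltcE => /andP[_].
congr (_ < _); rewrite raddf_sum; apply: eq_bigr => j _.
rewrite raddf_sum; apply: eq_bigr => l _.
rewrite [map_mx _ c _ _]mxE [map_mx _ c _ l]mxE [map_mx _ _ _ _]mxE.
by case: (curvature g i p j l) => x y; simpc.
Qed.

Section Extension.
Variables (i : chart P) (F : 'rV[R]_(1 + (m + m)) -> R).
Hypothesis F_smooth : smooth F.
Hypothesis FE : forall t p, 0 <= t <= 1 -> F (row_mx (const_mx t : 'rV[R]_1) p) = h t i (toC p).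

Let dF a v := 'D_(delta_mx 0 (rshift 1 a)) F v.
Let ddF a b v := 'D_(delta_mx 0 (rshift 1 a)) (dF b) v.
(** The derivatives of - ln F, written rationally in F and its derivatives. F is known to be
    positive only for t in [0, 1], so continuity is proved for these expressions on the box rather
    than for derivatives of - ln F. *)
Let G1 a v := - (dF a v * (F v)^-1).
Let G2 a b v := dF b v * dF a v * ((F v)^-1) ^+ 2 - ddF a b v * (F v)^-1.

Let cFV B v : time_box B v -> continuous_at v (fun v => (F v)^-1).
Proof.
move=> /time_boxP[t [p [-> t01 _]]]; apply: for_continuousV.
  by rewrite FE// gt_eqF// (metric_gt0 (hT t01)).
exact: (Cn_continuous (F_smooth 0%N)).
Qed.

Let cdF a v : continuous_at v (dF a).
Proof. exact: (Cn_continuous (Cn_derive _ (F_smooth 1%N))). Qed.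

Let cG1 B a v : time_box B v -> continuous_at v (G1 a).
Proof.
move=> /cFV FV; apply: for_continuousN.
by apply: for_continuousM => //; exact: cdF.
Qed.

Let cG2 B a b v : time_box B v -> continuous_at v (G2 a b).
Proof.
move=> /cFV FV; apply: for_continuousD.
  by apply: for_continuousM; [apply: for_continuousM; exact: cdF|exact: for_continuousX].
apply: for_continuousN; apply: for_continuousM => //.
exact: (Cn_continuous (Cn_derive _ (Cn_derive _ (F_smooth 2%N)))).
Qed.

Let hE t : 0 <= t <= 1 ->
  (fun q => h t i (toC q)) = (fun q => F (row_mx (const_mx t : 'rV[R]_1) q)).
Proof. by move=> t01; apply/funext => q; rewrite FE. Qed.

Let G1E t p a : 0 <= t <= 1 ->
  'D_(delta_mx 0 a) (chart_potential (h t) i) p = G1 a (row_mx (const_mx t : 'rV[R]_1) p).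
Proof.
by move=> t01; rewrite (derive_chart_potential (hT t01))/= hE// derive_row_mx -FE.
Qed.

Let G2E t p a b : 0 <= t <= 1 ->
  'D_(delta_mx 0 a) (fun q => 'D_(delta_mx 0 b) (chart_potential (h t) i) q) p =
  G2 a b (row_mx (const_mx t : 'rV[R]_1) p).
Proof.
move=> t01; rewrite (derive2_chart_potential (hT t01)).
have E c q : 'D_(delta_mx 0 c) (fun q => h t i (toC q)) q = dF c (row_mx (const_mx t : 'rV[R]_1) q).
  by rewrite hE// derive_row_mx.
have E2 : (fun q => 'D_(delta_mx 0 b) (fun q => h t i (toC q)) q) =
    (fun q => dF b (row_mx (const_mx t : 'rV[R]_1) q)) by apply/funext => q; exact: E.
have := derive_row_mx (dF b) t a p; rewrite -E2 -/(ddF a b _) => E3.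
by rewrite /G2 (FE _ t01) -E3 -(E b p) -(E a p).
Qed.

Lemma chart_potential_bounds_at (B : R) : exists C,
  forall (t : R) (p : 'rV[R]_(m + m)), 0 <= t <= 1 ->
  (forall a, `|p 0 a| <= B) ->
  (forall a, `|'D_(delta_mx 0 a) (chart_potential (h t) i) p| <= C) /\
  (forall a b,
     `|'D_(delta_mx 0 a) (fun q => 'D_(delta_mx 0 b) (chart_potential (h t) i) q) p| <= C).
Proof.
have [C1 _ C1P] : exists2 C, 0 < C & forall a, forall v, time_box B v -> `|G1 a v| <= C.
  apply: (@uniform_bound R 'I_(m + m) (fun a C => forall v, time_box B v -> `|G1 a v| <= C)).
    by move=> a C C' CC' H v Kv; exact: le_trans (H v Kv) CC'.
  move=> a.
  have cG v (Kv : time_box B v) : continuous_at v (G1 a) by exact: cG1 Kv.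
  by have [C CP] := compact_upper_bound (@time_box_compact B) cG; exists C.
have [C2 _ C2P] : exists2 C, 0 < C & forall ab : ('I_(m + m) * 'I_(m + m))%type,
    forall v, time_box B v -> `|G2 ab.1 ab.2 v| <= C.
  apply: (@uniform_bound R ('I_(m + m) * 'I_(m + m))%type
    (fun ab C => forall v, time_box B v -> `|G2 ab.1 ab.2 v| <= C)).
    by move=> a C C' CC' H v Kv; exact: le_trans (H v Kv) CC'.
  move=> ab.
  have cG v (Kv : time_box B v) : continuous_at v (G2 ab.1 ab.2) by exact: cG2 Kv.
  by have [C CP] := compact_upper_bound (@time_box_compact B) cG; exists C.
exists (Num.max C1 C2) => t p t01 pB.
have Kv : time_box B (row_mx (const_mx t : 'rV[R]_1) p) by apply/time_boxP; exists t, p.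
split=> [a|a b]; rewrite le_max; first by rewrite G1E// C1P.
by rewrite G2E// (C2P (a, b)) ?orbT.
Qed.

Lemma det_Re_curvature_lower_bound_at (B : R) : exists2 c, 0 < c &
  forall (t : R) (p : 'rV[R]_(m + m)), 0 <= t <= 1 -> (forall a, `|p 0 a| <= B) ->
  c <= \det (map_mx (@complex.Re R) (curvature (h t) i p)).
Proof.
(* The real part of the curvature as a function of time and position jointly. *)
pose M v : 'M[R]_m := \matrix_(j, l)
  ((G2 (lshift m j) (lshift m l) v + G2 (rshift m j) (rshift m l) v) / 4).
have ME t p : 0 <= t <= 1 ->
    M (row_mx (const_mx t : 'rV[R]_1) p) = map_mx (@complex.Re R) (curvature (h t) i p).
  move=> t01; apply/matrixP => j l; rewrite [LHS]mxE [RHS]mxE mxE /=.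
  by rewrite -!G2E.
have cM v : time_box B v -> continuous_at v (fun v => \det (M v)).
  move=> Kv; apply: for_continuous_det => j l.
  have -> : (fun y => M y j l) =
      (fun v => (G2 (lshift m j) (lshift m l) v + G2 (rshift m j) (rshift m l) v) / 4).
    by apply/funext => y; rewrite mxE.
  apply: for_continuousM; last exact: cst_continuous.
  by apply: for_continuousD; exact: cG2 Kv.
have M0 v : time_box B v -> 0 < \det (M v).
  by move=> /time_boxP[t [p [-> t01 _]]]; rewrite ME// det_Re_curvature_gt0//; exact: hT.
have [c c0 cP] := compact_lower_bound (@time_box_compact B) cM M0.
exists c => // t p t01 pB; rewrite -ME//; apply: cP.
by apply/time_boxP; exists t, p.
Qed.

End Extension.

Lemma chart_potential_bounds (B : R) : exists2 C, 0 < C &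
  forall i (t : R) (p : 'rV[R]_(m + m)), 0 <= t <= 1 -> (forall a, `|p 0 a| <= B) ->
  (forall a, `|'D_(delta_mx 0 a) (chart_potential (h t) i) p| <= C) /\
  (forall a b,
     `|'D_(delta_mx 0 a) (fun q => 'D_(delta_mx 0 b) (chart_potential (h t) i) q) p| <= C).
Proof.
apply: (@uniform_bound R (chart P) (fun i C => forall (t : R) (p : 'rV[R]_(m + m)),
  0 <= t <= 1 -> (forall a, `|p 0 a| <= B) ->
  (forall a, `|'D_(delta_mx 0 a) (chart_potential (h t) i) p| <= C) /\
  (forall a b,
     `|'D_(delta_mx 0 a) (fun q => 'D_(delta_mx 0 b) (chart_potential (h t) i) q) p| <= C))).
  move=> i C C' CC' H t p t01 pB; have [H1 H2] := H t p t01 pB.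
  by split=> [a|a b]; [exact: le_trans (H1 a) CC'|exact: le_trans (H2 a b) CC'].
by move=> i; have [F F_smooth FE] := hS i; exact: chart_potential_bounds_at F_smooth FE B.
Qed.

Lemma det_Re_curvature_lower_bound (B : R) : exists2 c, 0 < c &
  forall i (t : R) (p : 'rV[R]_(m + m)), 0 <= t <= 1 -> (forall a, `|p 0 a| <= B) ->
  c <= \det (map_mx (@complex.Re R) (curvature (h t) i p)).
Proof.
apply: (@uniform_pos R (chart P) (fun i c => forall (t : R) (p : 'rV[R]_(m + m)),
  0 <= t <= 1 -> (forall a, `|p 0 a| <= B) ->
  c <= \det (map_mx (@complex.Re R) (curvature (h t) i p)))).
  by move=> i c c' /andP[_ cc'] H t p t01 pB; exact: le_trans cc' (H t p t01 pB).
by move=> i; have [F F_smooth FE] := hS i; exact: det_Re_curvature_lower_bound_at F_smooth FE B.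
Qed.

End UniformBounds.

(** * Gaussian decay *)

Section QuadraticForms.
Variables (R : realType) (m : nat).

Definition quadform (A : 'M[R]_m) (v : 'rV[R]_m) : R :=
  \sum_j \sum_l v 0 j * v 0 l * A j l.

Lemma quadformE A v : quadform A v = (v *m A *m v^T) 0 0.
Proof.
rewrite /quadform exchange_big mxE; apply: eq_bigr => l _; rewrite !mxE mulr_suml.
by apply: eq_bigr => j _; rewrite mulrAC.
Qed.

Lemma dotrv_ge0 (v : 'rV[R]_m) : 0 <= dotrv v v.
Proof. by apply: sumr_ge0 => j _; rewrite -expr2 sqr_ge0. Qed.

Lemma enorm_sqr (v : 'rV[R]_m) : enorm v ^+ 2 = dotrv v v.
Proof. by rewrite sqr_sqrtr// dotrv_ge0. Qed.

Lemma ler_coord_enorm (v : 'rV[R]_m) j : `|v 0 j| <= enorm v.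
Proof.
rewrite -ler_sqr ?nnegrE ?sqrtr_ge0// enorm_sqr real_normK ?num_real//.
rewrite /dotrv (bigD1 j)//= expr2 lerDl.
by apply: sumr_ge0 => l _; rewrite -expr2 sqr_ge0.
Qed.

Lemma quadform_le (A : 'M[R]_m) (v : 'rV[R]_m) (C n : R) : 0 <= C ->
  (forall j l, `|A j l| <= C) -> (forall j, `|v 0 j| <= n) ->
  quadform A v <= m%:R ^+ 2 * C * n ^+ 2.
Proof.
move=> C0 AC vn.
have -> : m%:R ^+ 2 * C * n ^+ 2 = \sum_(j < m) \sum_(l < m) n * n * C.
  by rewrite !sumr_const card_ord -[RHS]mulr_natl -[X in _ = _ * X]mulr_natl; ring.
apply: ler_sum => j _; apply: ler_sum => l _.
apply: le_trans (ler_norm _) _; rewrite !normrM.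
by rewrite !ler_pM// mulr_ge0.
Qed.

Lemma mulmx_coord_le (p q : nat) (v : 'rV[R]_p) (A : 'M[R]_(p, q)) (n : R) j :
  (forall l, `|v 0 l| <= n) -> `|(v *m A) 0 j| <= n * \sum_l \sum_j `|A l j|.
Proof.
move=> vn; rewrite mxE mulr_sumr (le_trans (ler_norm_sum _ _ _))//.
apply: ler_sum => l _; rewrite normrM.
have n0 : 0 <= n by apply: le_trans (vn l).
apply: le_trans (ler_wpM2r (normr_ge0 _) (vn l)) _; rewrite ler_wpM2l//.
by rewrite (bigD1 j)//= lerDl sumr_ge0.
Qed.

End QuadraticForms.

Section Decay.
Variables (R : realType) (m : nat) (P : delzant R m) (h : R -> metric P).
Hypothesis hT : forall t, 0 <= t <= 1 -> toric_metric (h t).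
Hypothesis hS : smooth_path h.

Lemma expemb_le (B : R) (xi : 'rV[R]_m) : 0 <= B ->
  (forall j, expR (xi 0 j / 2) <= B) -> forall a, `|expemb xi 0 a| <= B.
Proof.
move=> B0 xiB a; case: (split_ordP a) => j ->.
  by rewrite expembE_l ger0_norm ?expR_ge0.
by rewrite expembE_r normr0.
Qed.

(** Each derivative in xi brings a factor e^(xi / 2) / 2, so the Hessian stays bounded as
    coordinates of xi tend to minus infinity, that is, up to the divisors. *)
Lemma hess_log_potential (g : metric P) (gT : toric_metric g) i xi j l :
  hess (log_potential g i) xi j l =
  expR (xi 0 l / 2) / 2 * (expR (xi 0 j / 2) / 2 *
    'D_(delta_mx 0 (lshift m j))
       (fun q => 'D_(delta_mx 0 (lshift m l)) (chart_potential g i) q) (expemb xi))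
  + 'D_(delta_mx 0 (lshift m l)) (chart_potential g i) (expemb xi) *
    ((j == l)%:R / 2 * expR (xi 0 l / 2) / 2).
Proof.
rewrite mxE.
have f2 := Cn_chart_potential gT 2 i.
have -> : (fun y => 'D_(delta_mx 0 l) (log_potential g i) y) =
  (fun y : 'rV[R]_m => expR (y 0 l / 2) / 2) *
  (fun y => 'D_(delta_mx 0 (lshift m l)) (chart_potential g i) (expemb y)).
  apply/funext => y.
  have d := derivableP (Cn_derivable (expemb y) (delta_mx 0 (lshift m l)) (CnW f2)).
  by have [_ ->] := is_derive_expemb d.
have d1 : is_derive xi (delta_mx 0 j) (fun y : 'rV[R]_m => expR (y 0 l / 2) / 2)
    ((j == l)%:R / 2 * expR (xi 0 l / 2) / 2).
  have -> : (fun y : 'rV[R]_m => expR (y 0 l / 2) / 2) =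
      2^-1 \*: (fun y : 'rV[R]_m => expR (y 0 l / 2)).
    by apply/funext => y; rewrite mulrC.
  rewrite [X in is_derive _ _ _ X]mulrC.
  by apply: is_deriveZ; exact: is_derive_expR_half.
have d2 := is_derive_expemb (derivableP
  (Cn_derivable (expemb xi) (delta_mx 0 (lshift m j)) (Cn_derive (lshift m l) f2))).
by have [_ ->] := is_deriveM d1 d2.
Qed.

Lemma hess_log_potential_le : exists2 C, 0 < C & forall i (t : R) (xi : 'rV[R]_m), 0 <= t <= 1 ->
  (forall j, xi 0 j <= 0) -> forall j l, `|hess (log_potential (h t) i) xi j l| <= C.
Proof.
have [C C0 CP] := chart_potential_bounds hT hS 1.
exists C => // i t xi t01 xi0 j l.
have e1 k : expR (xi 0 k / 2) <= 1 by rewrite -expR0 ler_expR ler_pdivrMr// mul0r.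
have [C1 C2] := CP i t (expemb xi) t01 (expemb_le ler01 e1).
rewrite (hess_log_potential (hT t01)).
have H k : `|expR (xi 0 k / 2) / 2| <= 2^-1.
  by rewrite ger0_norm ?divr_ge0 ?expR_ge0// ler_pdivrMr// mulVf.
have H' : `|(j == l)%:R / 2 * expR (xi 0 l / 2) / 2| <= 4^-1.
  rewrite -mulrA normrM (le_trans (ler_pM _ _ (_ : _ <= 2^-1) (H l)))//.
    by rewrite normrM ger0_norm// ger0_norm// ler_pdivrMr// mulVf//; case: (j == l).
  by lra.
rewrite (le_trans (ler_normD _ _))// !normrM.
have : `|expR (xi 0 l / 2) / 2| * (`|expR (xi 0 j / 2) / 2| *
   `|'D_(delta_mx 0 (lshift m j))
       (fun q => 'D_(delta_mx 0 (lshift m l)) (chart_potential (h t) i) q) (expemb xi)|)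
   <= 2^-1 * (2^-1 * C).
  by rewrite !ler_pM// ?H ?C2// mulr_ge0.
have : `|'D_(delta_mx 0 (lshift m l)) (chart_potential (h t) i) (expemb xi)| *
   `|(j == l)%:R / 2 * expR (xi 0 l / 2) / 2| <= C * 4^-1.
  by rewrite ler_pM.
rewrite !normrM; lra.
Qed.

Lemma hess_open_potential_le : exists2 C, 0 < C & forall (t : R) (rho v : 'rV[R]_m), 0 <= t <= 1 ->
  quadform (hess (open_potential (h t)) rho) v <= C * dotrv v v.
Proof.
have [C C0 CP] := hess_log_potential_le.
(* The chart will depend on rho, so [M] dominates the edge matrices of all charts at once. *)
pose M : R := \sum_i \sum_l \sum_j `|(@realedge R m P i)^T l j|.
have M0 : 0 <= M by do 3 (apply: sumr_ge0 => ? _).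
(* The added 1 keeps the constant positive also for m = 0. *)
exists (m%:R ^+ 2 * C * M ^+ 2 + 1) => [|t rho v t01].
  by rewrite ltr_wpDl// !mulr_ge0 ?sqr_ge0// ltW.
have [i rho0] := covering P rho.
rewrite quadformE (hess_open_potential (hT t01) i).
pose u := v *m (realedge i)^T.
have -> : v *m ((realedge i)^T *m hess (log_potential (h t) i) (rho *m (realedge i)^T)
    *m realedge i) *m v^T = u *m hess (log_potential (h t) i) (rho *m (realedge i)^T) *m u^T.
  by rewrite /u trmx_mul trmxK !mulmxA.
rewrite -quadformE.
have uM j : `|u 0 j| <= enorm v * M.
  apply: le_trans (mulmx_coord_le _ j (ler_coord_enorm v)) _.
  rewrite ler_wpM2l ?sqrtr_ge0// /M (bigD1 i)//= lerDl.
  by do 3 (apply: sumr_ge0 => ? _).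
apply: le_trans (quadform_le (ltW C0) (CP i t _ t01 rho0) uM) _.
rewrite exprMn enorm_sqr mulrDl mul1r -[leLHS]addr0 lerD ?dotrv_ge0//.
by rewrite mulrCA mulrC.
Qed.

Lemma gaussian_decay : exists2 kappa, 0 < kappa &
  forall (t : R) (rho x y : 'rV[R]_m), 0 <= t <= 1 ->
  y = \row_j 'D_(delta_mx 0 j) (open_potential (h t)) rho ->
  exists rho', dotrv x rho - open_potential (h t) rho + kappa * dotrv (x - y) (x - y)
    <= dotrv x rho' - open_potential (h t) rho'.
Proof.
have [C C0 CP] := hess_open_potential_le.
(* A step s (x - y) gains at least (s - C s^2) |x - y|^2; the maximum over s is at 1 / (2 C), with
   value |x - y|^2 / (4 C). *)
exists ((4 * C)^-1) => [|t rho x y t01 yE]; first by rewrite invr_gt0 mulr_gt0.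
pose z := x - y; pose s := (2 * C)^-1; pose v := s *: z.
(* Move along the gradient of <x, .> - psi at rho. *)
exists (rho + v).
have s0 : 0 < s by rewrite invr_gt0 mulr_gt0.
have := @taylor2_le R m (open_potential (h t)) rho v (C * dotrv v v)
   (Cn_open_potential (hT t01) 2).
rewrite mulr_ge0 ?dotrv_ge0 ?(ltW C0)// => /(_ isT (fun r => CP t r v t01)).
have -> : \sum_j v 0 j * 'D_(delta_mx 0 j) (open_potential (h t)) rho = dotrv v y.
  by apply: eq_bigr => j _; congr (_ * _); rewrite yE mxE.
rewrite -/z dotrvDr /v !dotrvZl !dotrvZr.
have -> : dotrv x z = dotrv z y + dotrv z z.
  by rewrite -dotrvDr subrKC dotrvC.
have -> : C * (s * (s * dotrv z z)) = 2^-1 * (s * dotrv z z).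
  by rewrite /s; field; rewrite gt_eqF.
have -> : (4 * C)^-1 = 2^-1 * s by rewrite /s; field; rewrite gt_eqF.
have aux (a b c d e r : R) : a <= b + r * e + 2^-1 * (r * d) ->
  c - b + 2^-1 * r * d <= c + r * (e + d) - a by lra.
exact: aux.
Qed.

End Decay.

(** * Lower bound for the norms of the sections *)

Section Elementary.
Variable R : realType.

Lemma expR_le_1D2 (s : R) : 0 <= s <= 2^-1 -> expR s <= 1 + 2 * s.
Proof.
move=> /andP[s0 s2].
have H : 1 - s <= (expR s)^-1 by rewrite -expRN expR_ge1Dx.
have s1 : 0 < 1 - s by lra.
have : expR s <= (1 - s)^-1 by rewrite -[expR s]invrK lef_pV2// posrE ?invr_gt0 ?expR_gt0.
move=> /le_trans; apply; rewrite -[leLHS]mul1r ler_pdivrMr//; nra.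
Qed.

(** r is a modulus, 2 / k its outward shift, and tau the tolerance in log |w|^2 left for a box
    around the shifted point. *)
Lemma shifted_radius (r k tau : R) : 0 <= r <= 1 -> 1 <= k -> `|tau| <= (2 * k)^-1 ->
  r + k^-1 <= (r + 2 / k) * expR (tau / 2) <= r + 4 / k.
Proof.
move=> /andP[r0 r1] k1; set d := (2 * k)^-1; rewrite ler_norml => /andP[tau1 tau2].
have k0 : 0 < k by lra.
have d0 : 0 < d by rewrite invr_gt0; lra.
have d2 : d <= 2^-1 by rewrite lef_pV2 ?posrE//; lra.
have -> : k^-1 = 2 * d by rewrite /d; field; rewrite gt_eqF.
have L : 1 - d / 2 <= expR (tau / 2) by apply: le_trans (expR_ge1Dx _); lra.
have U : expR (tau / 2) <= 1 + d.
  have : expR (tau / 2) <= expR (d / 2) by rewrite ler_expR; lra.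
  move=> /le_trans; apply; apply: (le_trans (@expR_le_1D2 _ _)); lra.
by apply/andP; split; nra.
Qed.

End Elementary.

Section NormLowerBound.
Variables (R : realType) (m : nat) (P : delzant R m) (h : R -> metric P).
Hypothesis hT : forall t, 0 <= t <= 1 -> toric_metric (h t).
Hypothesis hS : smooth_path h.

(** The variation is measured in moduli and not in xi, where moving a modulus near 0 by 1 / k is an
    unbounded displacement. The bound 5 is the worst case of 1 + 4 / k. *)
Lemma log_potential_lipschitz : exists2 C, 0 < C &
  forall i (t : R) (xi xi' : 'rV[R]_m) (e : R), 0 <= t <= 1 -> 0 <= e ->
  (forall j, expR (xi 0 j / 2) <= 5) -> (forall j, expR (xi' 0 j / 2) <= 5) ->
  (forall j, `|expR (xi' 0 j / 2) - expR (xi 0 j / 2)| <= e) ->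
  `|log_potential (h t) i xi' - log_potential (h t) i xi| <= C * e.
Proof.
have [C C0 CP] := chart_potential_bounds hT hS 5.
exists ((m + m)%:R * C + 1) => [|i t xi xi' e t01 e0 xi5 xi5' xie].
  by rewrite ltr_wpDl// mulr_ge0// ltW.
pose v := expemb xi' - expemb xi.
have vE a : v 0 a = expemb xi' 0 a - expemb xi 0 a.
  by rewrite /v; move: (expemb xi) (expemb xi') => u u'; rewrite !mxE.
have ve a : `|v 0 a| <= e.
  rewrite vE; case: (split_ordP a) => j ->; first by rewrite !expembE_l.
  by rewrite !expembE_r subrr normr0.
have f1 := Cn_chart_potential (hT t01) 1 i.
have vC s a : 0 <= s <= 1 ->
    `|'D_(delta_mx 0 a) (chart_potential (h t) i) (expemb xi + s *: v)| <= C.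
  move=> /andP[s0 s1]; apply: (CP i t _ t01 _).1 => b.
  have -> : (expemb xi + s *: v) 0 b = (1 - s) * expemb xi 0 b + s * expemb xi' 0 b.
    have -> : (expemb xi + s *: v) 0 b = expemb xi 0 b + s * v 0 b.
      by move: (expemb xi) (v) => u u'; rewrite !mxE.
    by rewrite vE; ring.
  rewrite (le_trans (ler_normD _ _))// !normrM (ger0_norm s0) ger0_norm ?subr_ge0//.
  have := expemb_le (ler0n R 5) xi5 b; have := expemb_le (ler0n R 5) xi5' b.
  move: `|expemb xi 0 b| `|expemb xi' 0 b| => x y; nra.
have xv : expemb xi + v = expemb xi' by rewrite /v addrC subrK.
have := lipschitz_Cn1 f1 vC; rewrite xv => /le_trans; apply.
have -> : ((m + m)%:R * C + 1) * e = \sum_(a < m + m) e * C + e.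
  by rewrite sumr_const card_ord -mulr_natl; ring.
by rewrite -[leLHS]addr0 lerD//; apply: ler_sum => a _; rewrite ler_wpM2r// ltW.
Qed.

Lemma sec_norm2_near (k : nat) (a : 'rV[int]_m) (i : chart P) (t : R)
    (rho rho' : 'rV[R]_m) (L : R) :
  0 <= t <= 1 -> lattice_points P k a ->
  (forall j, (rho *m (realedge i)^T) 0 j <= (rho' *m (realedge i)^T) 0 j) ->
  `|log_potential (h t) i (rho' *m (realedge i)^T) -
    log_potential (h t) i (rho *m (realedge i)^T)| * k%:R <= L ->
  expR (dotrv (intrv R a) rho - k%:R * open_potential (h t) rho) * expR (- L) <=
  expR (dotrv (intrv R a) rho' - k%:R * open_potential (h t) rho').
Proof.
move=> t01 Pa rr HL; rewrite -expRD ler_expR.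
have E r : dotrv (intrv R a) r - k%:R * open_potential (h t) r =
    dotrv (intrv R (chart_exp k i a)) (r *m (realedge i)^T) -
    k%:R * log_potential (h t) i (r *m (realedge i)^T).
  by rewrite dotrv_chart_exp (open_potentialE (hT t01) i); ring.
rewrite !E.
have D : dotrv (intrv R (chart_exp k i a)) (rho *m (realedge i)^T) <=
  dotrv (intrv R (chart_exp k i a)) (rho' *m (realedge i)^T).
  apply: ler_sum => j _; apply: ler_wpM2l => //.
  by rewrite [intrv _ _ _ _]mxE ler0z chart_exp_ge0.
have := le_trans (ler_wpM2r (ler0n R k) (ler_norm _)) HL.
move: D (log_potential _ _ _) (log_potential _ _ _) => D p p'.
by rewrite mulrBl; move: D; nra.
Qed.

(* The chart coordinates of rho are at most 1 in modulus; those of rho' exceed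
   them by a quantity between 1 / k and 4 / k. *)
Lemma integrand_lower_bound : exists2 c, 0 < c &
  forall (k : nat) (a : 'rV[int]_m) (t : R) (i : chart P) (rho rho' : 'rV[R]_m),
  (1 <= k)%N -> 0 <= t <= 1 -> lattice_points P k a ->
  (forall j, (rho *m (realedge i)^T) 0 j <= 0) ->
  (forall j, `|(rho' *m (realedge i)^T) 0 j -
     2 * ln (expR ((rho *m (realedge i)^T) 0 j / 2) + 2 / k%:R)| <= (2 * k%:R)^-1) ->
  c * (k%:R ^- 2) ^+ m * expR (dotrv (intrv R a) rho - k%:R * open_potential (h t) rho) <=
  expR (dotrv (intrv R a) rho' - k%:R * open_potential (h t) rho') *
  \det (hess (log_potential (h t) ord0) (rho' *m (realedge (ord0 : chart P))^T)).
Proof.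
have [C C0 CP] := log_potential_lipschitz.
have [c c0 cP] := det_Re_curvature_lower_bound hT hS 5.
(* Moduli move by at most 4 / k, hence k times the potential by at most 4 C. *)
exists (expR (- (C * 4)) * c) => [|k a t i rho rho' k1 t01 Pa rho0 near].
  by rewrite mulr_gt0// expR_gt0.
have k1R : 1 <= k%:R :> R by rewrite ler1n.
have k0 : 0 < k%:R :> R by rewrite ltr0n.
set xi := rho *m _ in rho0 near; set xi' := rho' *m _ in near.
have r1 j : 0 <= expR (xi 0 j / 2) <= 1.
  by rewrite expR_ge0 -expR0 ler_expR ler_pdivrMr// mul0r rho0.
have W j : expR (xi 0 j / 2) + k%:R^-1 <= expR (xi' 0 j / 2) <= expR (xi 0 j / 2) + 4 / k%:R.
  have := shifted_radius (r1 j) k1R (near j).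
  set r := expR (xi 0 j / 2) + 2 / k%:R.
  have r0 : 0 < r by rewrite /r ltr_pwDl ?expR_gt0// divr_ge0// ltW.
  suff -> : r * expR ((xi' 0 j - 2 * ln r) / 2) = expR (xi' 0 j / 2) by [].
  by rewrite -[X in X * _](lnK (_ : r \in Num.pos)) ?posrE// -expRD; congr expR; lra.
have kV : 0 < (k%:R^-1 : R) <= 1 by rewrite invr_gt0 k0 invf_le1.
have kw j : k%:R^-1 <= expR (xi' 0 j / 2) by have := W j; have := r1 j; lra.
have w5 j : expR (xi' 0 j / 2) <= 5 by have := W j; have := r1 j; lra.
have v5 j : expR (xi 0 j / 2) <= 5 by have := r1 j; lra.
have vw j : `|expR (xi' 0 j / 2) - expR (xi 0 j / 2)| <= 4 / k%:R.
  by rewrite ler_norml; have := W j; lra.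
have dk : 0 <= 4 / k%:R :> R by rewrite divr_ge0// ltW.
have le1 : expR (dotrv (intrv R a) rho - k%:R * open_potential (h t) rho) * expR (- (C * 4)) <=
    expR (dotrv (intrv R a) rho' - k%:R * open_potential (h t) rho').
  apply: (@sec_norm2_near k a i) => //.
    by move=> j; rewrite -(ler_pM2r (_ : 0 < 2^-1 :> R))// -ler_expR; have := W j; lra.
  rewrite -ler_pdivlMr// -mulrA.
  exact: CP.
have kV2 : 0 <= k%:R ^- 2 :> R by rewrite invr_ge0 exprn_ge0 ?ltW.
(* The outward shift pays off here: prod |w_j|^2 is the factor by which det Hess psi degenerates. *)
have le3 : (k%:R ^- 2) ^+ m <= \prod_j expR (xi' 0 j).
  have -> : (k%:R ^- 2) ^+ m = \prod_(j < m) (k%:R ^- 2 : R) by rewrite prodr_const card_ord.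
  apply: ler_prod => j _; rewrite kV2/= -expR_half_sqr -exprVn.
  by apply: lerXn2r; rewrite ?nnegrE ?invr_ge0 ?expR_ge0 ?kw.
have le2 : c * (k%:R ^- 2) ^+ m <=
    \det (hess (log_potential (h t) ord0) (rho' *m (realedge (ord0 : chart P))^T)).
  rewrite (det_hess_log_potential (hT t01) ord0 i) (det_hess_log_potential_Re (hT t01)).
  rewrite mulrC ler_pM ?exprn_ge0 ?(ltW c0)//.
  by apply: cP => //; exact: expemb_le.
have := ler_pM _ _ le1 le2.
rewrite mulr_ge0 ?expR_ge0// mulr_ge0 ?exprn_ge0 ?(ltW c0)// => /(_ isT isT).
by apply: le_trans; rewrite le_eqVlt; apply/orP; left; apply/eqP; ring.
Qed.

End NormLowerBound.

(** * Lower bound of Q by a box in the chart of integration *)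

Section IntegralLowerBound.
Variables (R : realType) (m : nat) (P : delzant R m) (h : R -> metric P).
Hypothesis hT : forall t, 0 <= t <= 1 -> toric_metric (h t).
Hypothesis hS : smooth_path h.

(** The sides are proportional to the moduli e^(eta_j / 2), which may be arbitrarily large or small
    in the chart of integration; only the relative variation of |w_j|^2 is controlled. *)
Lemma abs2_box (eta : 'rV[R]_m) (e : R) (q : 'rV[R]_(m + m)) j : 0 < e <= 1 ->
  (forall b, expemb eta 0 b <= q 0 b <= expemb eta 0 b +
     (row_mx (\row_j (expR (eta 0 j / 2) * e)) (\row_j (expR (eta 0 j / 2) * e))) 0 b) ->
  expR (eta 0 j) <= abs2 j q <= expR (eta 0 j) * (1 + 4 * e).
Proof.
move=> /andP[e0 e1] qbox.
have := qbox (lshift m j); rewrite row_mxEl expembE_l mxE.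
have := qbox (rshift m j); rewrite row_mxEr expembE_r mxE add0r.
rewrite -(expR_half_sqr (eta 0 j)) /abs2; have := expR_gt0 (eta 0 j / 2).
move: (expR (eta 0 j / 2)) (q 0 (rshift m j)) (q 0 (lshift m j)) => a y x a0.
move=> /andP[y0 y1] /andP[x0 x1].
have ae : 0 < a * e by rewrite mulr_gt0.
apply/andP; split.
  rewrite -[leLHS]addr0; apply: lerD _ (sqr_ge0 y).
  by apply: lerXn2r => //; rewrite nnegrE ?(ltW a0)// (le_trans (ltW a0)).
have X : x ^+ 2 <= (a + a * e) ^+ 2.
  by apply: lerXn2r => //; rewrite nnegrE; [exact: le_trans (ltW a0) x0|rewrite ltW// addr_gt0].
have Y : y ^+ 2 <= (a * e) ^+ 2 by apply: lerXn2r => //; rewrite nnegrE// ltW.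
apply: le_trans (lerD X Y) _.
have -> : (a + a * e) ^+ 2 + (a * e) ^+ 2 = a ^+ 2 * (1 + 2 * e + 2 * e * e) by ring.
rewrite ler_wpM2l ?sqr_ge0//; nra.
Qed.

Lemma logabs2_box (eta : 'rV[R]_m) (e : R) (q : 'rV[R]_(m + m)) j : 0 <= e ->
  expR (eta 0 j) <= abs2 j q <= expR (eta 0 j) * (1 + 4 * e) ->
  `|(logabs2 q - eta) 0 j| <= 4 * e.
Proof.
move=> e0 /andP[q1 q2].
have q0 : 0 < abs2 j q by apply: lt_le_trans q1; exact: expR_gt0.
have -> : (logabs2 q - eta) 0 j = ln (abs2 j q) - eta 0 j by rewrite !mxE.
have L : eta 0 j <= ln (abs2 j q) by rewrite -[leLHS]expRK ler_ln ?posrE ?expR_gt0.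
have U : ln (abs2 j q) <= eta 0 j + 4 * e.
  rewrite -[leRHS]expRK ler_ln ?posrE ?expR_gt0// (le_trans q2)// expRD.
  by rewrite ler_wpM2l ?expR_ge0// expR_ge1Dx.
by rewrite ler_norml; lra.
Qed.

(** The good point is found in a chart i, the integral is taken in [ord0]. Their logarithmic
    coordinates are linearly related, so a box of relative size 1 / k in [ord0] stays within the
    tolerance in chart i, and its volume compensates the factor prod |w_j|^-2 of the density. *)
Lemma integral_lower_bound : exists2 c, 0 < c &
  forall (k : nat) (a : 'rV[int]_m) (t : R) (rho : 'rV[R]_m),
  (1 <= k)%N -> 0 <= t <= 1 -> lattice_points P k a ->
  ((c * (k%:R ^- 4) ^+ m * expR (dotrv (intrv R a) rho - k%:R * open_potential (h t) rho))%:E <=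
  integral_rV (fun p : 'rV[R]_(m + m) =>
    (sec_norm2 (h t) k a ord0 (toC p) * volume_density (h t) ord0 p)%:E))%E.
Proof.
have [c c0 cP] := integrand_lower_bound hT hS.
(* [A i] takes logarithmic coordinates of the chart [ord0] to those of the chart i. *)
pose A (i : chart P) : 'M[R]_m := (invmx (realedge (ord0 : chart P)))^T *m (realedge i)^T.
pose M : R := 1 + \sum_i \sum_l \sum_j `|A i l j|.
have M1 : 1 <= M by rewrite lerDl; do 3 (apply: sumr_ge0 => ? _).
have M0 : 0 < M by lra.
exists (c / pi ^+ m * ((128 * M ^+ 2)^-1) ^+ m) => [|k a t rho k1 t01 Pa].
  by rewrite mulr_gt0 ?divr_gt0 ?exprn_gt0 ?pi_gt0// invr_gt0 mulr_gt0// exprn_gt0.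
have k1R : 1 <= k%:R :> R by rewrite ler1n.
have k0 : 0 < k%:R :> R by rewrite ltr0n.
have [i rho0] := covering P rho.
set xi := rho *m (realedge i)^T in rho0.
(* The point with moduli shifted outwards by 2 / k, in the chart i; [eta] is the same point in the
   chart [ord0]. *)
pose eta' : 'rV[R]_m := \row_j (2 * ln (expR (xi 0 j / 2) + 2 / k%:R)).
pose eta := eta' *m (invmx (realedge i))^T *m (realedge (ord0 : chart P))^T.
have unitK (l : chart P) : (realedge l)^T *m (invmx (realedge l))^T = 1%:M.
  by rewrite -trmx_mul mulVmx ?realedge_unit// trmx1.
have unitK' (l : chart P) : (invmx (realedge l))^T *m (realedge l)^T = 1%:M.
  by rewrite -trmx_mul mulmxV ?realedge_unit// trmx1.
have etaA : eta *m A i = eta'.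
  rewrite /eta /A -!mulmxA (mulmxA _ (invmx _)^T (realedge i)^T) unitK mul1mx.
  by rewrite unitK' mulmx1.
(* An error of 4 e in the chart [ord0] becomes at most 4 e M = 1 / (2 k) in the chart i, the
   tolerance of [integrand_lower_bound]. *)
pose e : R := (8 * k%:R * M)^-1.
have kM : 1 <= k%:R * M by rewrite -[leLHS]mul1r ler_pM.
have e0 : 0 < e by rewrite invr_gt0 -mulrA mulr_gt0// mulr_gt0.
have e1 : e <= 4^-1 by rewrite /e lef_pV2 ?posrE// -mulrA ?mulr_gt0//; lra.
have e01 : 0 < e <= 1 by lra.
have e2 : 1 + 4 * e <= 2 by lra.
pose len := row_mx (\row_j (expR (eta 0 j / 2) * e)) (\row_j (expR (eta 0 j / 2) * e)).
set E := expR _.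
(* The bound of the integrand on the box, where |w_j|^2 <= 2 e^(eta_j). *)
pose S := c * (k%:R ^- 2) ^+ m * E * (\prod_j (2 * expR (eta 0 j))^-1) / pi ^+ m.
have S0 : 0 <= S.
  rewrite /S !mulr_ge0 ?invr_ge0 ?exprn_ge0 ?pi_ge0 ?invr_ge0 ?exprn_ge0 ?expR_ge0
    ?(ltW c0) ?(ltW k0)//.
  by apply: prodr_ge0 => j _; rewrite invr_ge0 mulr_ge0 ?expR_ge0.
(* Per coordinate, the side lengths and the density leave e^2 / 2 = 1 / (128 k^2 M^2); the factor
   k^-2 already in [S] makes it k^-4. *)
have -> : c / pi ^+ m * ((128 * M ^+ 2)^-1) ^+ m * (k%:R ^- 4) ^+ m * E = S * \prod_b len 0 b.
  have -> : \prod_b len 0 b = \prod_j (expR (eta 0 j / 2) * e * (expR (eta 0 j / 2) * e)).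
    rewrite big_split_ord big_split; congr (_ * _); apply: eq_bigr => j _.
      by rewrite row_mxEl mxE.
    by rewrite row_mxEr mxE.
  rewrite /S.
  have -> (u v w x y z : R) : u * v * w * x / y * z = u * w / y * v * (x * z) by ring.
  rewrite -big_split/=.
  have -> : \prod_(j < m) ((2 * expR (eta 0 j))^-1 *
      (expR (eta 0 j / 2) * e * (expR (eta 0 j / 2) * e))) = (e ^+ 2 / 2) ^+ m.
    rewrite -[X in _ ^+ X]card_ord -prodr_const; apply: eq_bigr => j _.
    rewrite -(expR_half_sqr (eta 0 j)); have := expR_gt0 (eta 0 j / 2).
    by move: (expR (eta 0 j / 2)) => x x0; field; rewrite gt_eqF.
  have gen (c' p u v w k' e' : R) : u * v = k' * e' -> c' / p * u * v * w = c' * w / p * k' * e'.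
    by move=> H; transitivity (c' / p * w * (u * v)); [ring|rewrite H; ring].
  apply: gen; rewrite -!exprMn; congr (_ ^+ m).
  by rewrite /e; field; rewrite !gt_eqF.
apply: (@integral_rV_ge_box R (m + m) _ (expemb eta)) => //.
- move=> j; case: (split_ordP j) => l ->;
  by rewrite ?row_mxEl ?row_mxEr mxE mulr_ge0 ?expR_ge0 ?ltW.
- move=> p; rewrite lee_fin mulr_ge0 ?volume_density_ge0//; last exact: hT.
  by rewrite mulr_ge0 ?sqr_ge0// exprn_ge0// ltW// (metric_gt0 (hT t01)).
move=> q qbox.
have qE j := abs2_box j e01 qbox.
have q0 j : 0 < abs2 j q by apply: lt_le_trans (expR_gt0 _) (andP (qE j)).1.
have [theta qtheta] := toC_orbit (ord0 : chart P) q0.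
set rho' := logabs2 q *m _ in qtheta.
have rho'E : rho' *m (realedge (ord0 : chart P))^T = logabs2 q.
  by rewrite /rho' -mulmxA unitK' mulmx1.
have near j : `|(rho' *m (realedge i)^T) 0 j - 2 * ln (expR (xi 0 j / 2) + 2 / k%:R)|
    <= (2 * k%:R)^-1.
  have -> : (rho' *m (realedge i)^T) 0 j - 2 * ln (expR (xi 0 j / 2) + 2 / k%:R) =
     ((logabs2 q - eta) *m A i) 0 j.
    have mxB (u v : 'rV[R]_m) : (u - v) 0 j = u 0 j - v 0 j by rewrite !mxE.
    rewrite mulmxBl etaA mxB /rho' -mulmxA -/(A i); congr (_ - _).
    by rewrite [RHS]mxE.
  have D l : `|(logabs2 q - eta) 0 l| <= 4 * e by apply: logabs2_box (qE l); exact: ltW.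
  apply: le_trans (mulmx_coord_le (A i) j D) _.
  have -> : (2 * k%:R)^-1 = 4 * e * M.
    by rewrite /e; field; rewrite !gt_eqF.
  rewrite ler_wpM2l ?mulr_ge0 ?(ltW e0)// /M (bigD1 i)//= addrCA lerDl addr_ge0//.
  by do 3 (apply: sumr_ge0 => ? _).
have le1 := cP k a t i rho rho' k1 t01 Pa rho0 near.
rewrite lee_fin qtheta sec_norm2_orbit//; last exact: hT.
rewrite (volume_density_logabs2 (hT t01))// -rho'E !mulrA /S /E.
rewrite ler_wpM2r ?invr_ge0 ?exprn_ge0 ?pi_ge0// ler_pM//.
- by rewrite !mulr_ge0 ?exprn_ge0 ?invr_ge0 ?exprn_ge0 ?expR_ge0 ?(ltW c0) ?(ltW k0).
- by apply: prodr_ge0 => j _; rewrite invr_ge0 mulr_ge0 ?expR_ge0.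
apply: ler_prod => j _; rewrite invr_ge0 mulr_ge0 ?expR_ge0//=.
rewrite lef_pV2 ?posrE ?mulr_gt0 ?expR_gt0//; have /andP[_] := qE j.
move=> /le_trans; apply; rewrite mulrC; apply: ler_wpM2r; [exact: expR_ge0|exact: e2].
Qed.

End IntegralLowerBound.

(** * Counting lattice points *)

Section Counting.
Variable R : realType.

Lemma normc_ge0 (z : R[i]) : 0 <= normc z.
Proof. by case: z => x y; exact: sqrtr_ge0. Qed.

Lemma normc_sum_le (I : Type) (s : seq I) (F : I -> R[i]) :
  normc (\sum_(i <- s) F i) <= \sum_(i <- s) normc (F i).
Proof.
elim: s => [|i s IH]; first by rewrite !big_nil normc0.
rewrite !big_cons; apply: le_trans (_ : _ <= normc (F i) + normc (\sum_(j <- s) F j)) _.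
  by have := ComplexField.lec_normD (F i) (\sum_(j <- s) F j) => /andP[].
by rewrite lerD2l.
Qed.

Lemma normc_fsbig_diff_le (I : choiceType) (A B : set I) (F : I -> R[i]) (M : R) (n : nat)
    (s : seq I) :
  (size s <= n)%N -> (forall a, A a -> a \in s) -> B `<=` A -> 0 <= M ->
  (forall a, A a -> ~ B a -> normc (F a) <= M) ->
  normc (\sum_(a \in A) F a - \sum_(a \in B) F a) <= n%:R * M.
Proof.
move=> sn As BA M0 FM.
have finA : finite_set A.
  apply: (@sub_finite_set _ _ [set` s]) => [a /As //|].
  by exact: finite_seq.
rewrite (fsbigID B)//= (_ : A `&` B = B); last exact/setIidr.
rewrite addrAC subrr add0r fsbig_finite//=; last exact: finite_setIl.
apply: le_trans (normc_sum_le _ _) _.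
apply: le_trans (_ : _ <= \sum_(a <- fset_set (A `&` ~` B)) M) _.
  rewrite !big_seq; apply: ler_sum => a; rewrite in_fset_set; last exact: finite_setIl.
  by rewrite inE => -[Aa Ba]; exact: FM.
rewrite big_const_seq count_predT iter_addr_0 -[leLHS]mulr_natl ler_wpM2r// ler_nat.
apply: leq_trans sn; apply: uniq_leq_size => // a.
rewrite in_fset_set; last exact: finite_setIl.
by rewrite inE => -[/As].
Qed.

Variables (m : nat) (P : delzant R m).

Lemma lattice_points_bounded : exists V : nat, forall k a, lattice_points P k a ->
  forall j, (absz (a 0%R j) <= k * V)%N.
Proof.
pose V := (\sum_l \sum_j absz (vert P l 0%R j))%N.
exists V => k a [x [c [c0 c1 xE]] ax] j.
rewrite -(ler_nat R) natrM.
have -> : (absz (a 0 j))%:R = `|(intrv R a) 0 j| :> R by rewrite mxE -intr_norm natr_absz.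
rewrite ax xE mxE normrM ger0_norm// ler_wpM2l// summxE.
apply: le_trans (ler_norm_sum _ _ _) _.
have -> : V%:R = \sum_l c l * V%:R by rewrite -mulr_suml c1 mul1r.
apply: ler_sum => l _.
rewrite mxE normrM (ger0_norm (c0 l)) ler_wpM2l// mxE -intr_norm -natr_absz ler_nat.
by rewrite /V (bigD1 l)//= (bigD1 j)//= -addnA leq_addr.
Qed.

Lemma lattice_points_count : exists V : nat, forall k, exists s : seq 'rV[int]_m,
  (size s <= (2 * (k * V)).+1 ^ m)%N /\ forall a, lattice_points P k a -> a \in s.
Proof.
have [V VP] := lattice_points_bounded; exists V => k.
pose n := (2 * (k * V)).+1.
(* The cube [- k V, k V]^m, shifted so that coordinates run from 0 to 2 k V. *)
pose dec (u : {ffun 'I_m -> 'I_n}) : 'rV[int]_m := \row_j ((u j)%:Z - (k * V)%:Z).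
exists [seq dec u | u : {ffun 'I_m -> 'I_n}]; split.
  by rewrite size_image card_ffun !card_ord.
move=> a /VP Pa; apply/fintype.imageP.
exists [ffun j => inord (absz (a 0 j + (k * V)%:Z))] => //.
apply/rowP => j; rewrite mxE ffunE inordK.
  by have := Pa j; move: (a 0 j) (k * V)%N => x N; lia.
by have := Pa j; rewrite /n; move: (a 0 j) (k * V)%N => x N; lia.
Qed.

End Counting.

(** * Decay of the sections *)

Section Pointwise.
Variables (R : realType) (m : nat) (P : delzant R m) (h : R -> metric P).
Hypothesis hT : forall t, 0 <= t <= 1 -> toric_metric (h t).
Hypothesis hS : smooth_path h.
Variable mu : R -> chart P -> 'rV[R[i]]_m -> 'rV[R]_m.
Hypothesis mu_moment : forall t, 0 <= t <= 1 -> is_moment_map (h t) (mu t).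

Let lattice_dist2 (k : nat) (a : 'rV[int]_m) (t : R) i w :=
  enorm (k%:R^-1 *: intrv R a - mu t i w) ^+ 2.

Lemma Qnorm_ge0 t k a : 0 <= t <= 1 -> 0 <= Qnorm (h t) k a.
Proof.
move=> t01; apply: fine_ge0; apply: integral_rV_ge0 => p.
rewrite lee_fin mulr_ge0 ?volume_density_ge0//; last exact: hT.
by rewrite mulr_ge0 ?sqr_ge0// exprn_ge0// ltW// (metric_gt0 (hT t01)).
Qed.

(** The exponential stays on the left, so that the bound has the form g <= constant that
    [open_orbit_dense] extends to the whole chart. *)
Lemma sec_norm2_orbit_decay : exists kappa A : R, [/\ 0 < kappa, 0 < A &
  forall (k : nat) (a : 'rV[int]_m) (t : R) (i : chart P) (rho theta : 'rV[R]_m) w,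
  (1 <= k)%N -> 0 <= t <= 1 -> lattice_points P k a ->
  w = orbit_coord i (expz rho theta) ->
  sec_norm2 (h t) k a i w * expR (k%:R * kappa * lattice_dist2 k a t i w) / Qnorm (h t) k a <=
  A * (k%:R ^+ 4) ^+ m].
Proof.
have [kappa kappa0 decay] := gaussian_decay hT hS.
have [c c0 lower] := integral_lower_bound hT hS.
exists kappa, c^-1; split; rewrite ?invr_gt0// => k a t i rho theta w k1 t01 Pa wE.
have k0 : 0 < k%:R :> R by rewrite ltr0n.
have [_ /(_ i rho theta) muE] := mu_moment t01.
have := decay t rho (k%:R^-1 *: intrv R a) _ t01 muE.
rewrite -wE -enorm_sqr -/(lattice_dist2 k a t i w) => -[rho' le1].
have := lower k a t rho' k1 t01 Pa.
have le2 : sec_norm2 (h t) k a i w * expR (k%:R * kappa * lattice_dist2 k a t i w) <=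
    expR (dotrv (intrv R a) rho' - k%:R * open_potential (h t) rho').
  rewrite {1}wE sec_norm2_orbit; last exact: hT.
  rewrite -expRD ler_expR.
  have E r : dotrv (intrv R a) r = k%:R * dotrv (k%:R^-1 *: intrv R a) r.
    by rewrite dotrvZl mulrA mulfV ?mul1r// gt_eqF.
  by rewrite !E -mulrA -!mulrBr -mulrDr ler_wpM2l// ltW.
have Q0 := Qnorm_ge0 k a t01; move: Q0; rewrite /Qnorm.
have kc : 0 < c * (k%:R ^- 4) ^+ m by rewrite mulr_gt0// exprn_gt0// invr_gt0 exprn_gt0.
have kA0 : 0 <= c^-1 * (k%:R ^+ 4) ^+ m :> R.
  by rewrite mulr_ge0 ?invr_ge0 ?exprn_ge0 ?(ltW c0)// ltW.
(* An infinite integral makes [Qnorm], and hence the quotient, equal to 0. *)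
case: (integral_rV _) => [r| |] /=; last 2 first.
- by rewrite invr0 mulr0.
- by rewrite invr0 mulr0.
move=> r0; rewrite lee_fin => le3; rewrite ler_pdivrMr; last first.
  by apply: lt_le_trans le3; rewrite mulr_gt0// expR_gt0.
apply: le_trans le2 _.
have -> : c^-1 * (k%:R ^+ 4) ^+ m = (c * (k%:R ^- 4) ^+ m)^-1.
  by rewrite invfM exprVn invrK.
by rewrite ler_pdivlMl.
Qed.

(** Nonnegative exponents make the squared monomial a polynomial in the |w_j|^2, continuous also
    where coordinates vanish. *)
Lemma continuous_sec_norm2 t k a i : 0 <= t <= 1 -> lattice_points P k a ->
  continuous (fun p => sec_norm2 (h t) k a i (toC p)).
Proof.
move=> t01 Pa p.
have -> : (fun p => sec_norm2 (h t) k a i (toC p)) =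
  (fun p => (\prod_j abs2 j p ^+ absz (chart_exp k i a 0 j)) * h t i (toC p) ^+ k).
  apply/funext => q; rewrite /sec_norm2; congr (_ * _).
  rewrite /monomial; have -> : normc (\prod_j toC q 0 j ^ chart_exp k i a 0 j) =
     \prod_j normc (toC q 0 j) ^+ absz (chart_exp k i a 0 j).
    rewrite (big_morph _ (@normcM R) (normc1 R)); apply: eq_bigr => j _.
    have := chart_exp_ge0 i Pa j; case: (chart_exp k i a 0 j) => // n _ /=.
    by elim: n => [|n IH]; [exact: normc1|rewrite exprSz normcM IH exprS].
  by rewrite -prodrXl; apply: eq_bigr => j _; rewrite -exprM mulnC exprM normc_toC.
apply: for_continuousM.
  by apply: for_continuous_prod => j _; apply: for_continuousX; exact: continuous_abs2.
apply: for_continuousX; exact: (Cn_continuous (metric_smooth (hT t01) i 0%N)).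
Qed.

(** Adding a small s > 0 to all real parts makes every coordinate nonzero: negative real parts stay
    negative, the others become positive. An inequality g p > M would survive this. *)
Lemma open_orbit_dense (i : chart P) (g : 'rV[R]_(m + m) -> R) (M : R) : continuous g ->
  (forall rho theta p, toC p = orbit_coord i (expz rho theta) -> g p <= M) ->
  forall p, g p <= M.
Proof.
move=> cg gM p; rewrite leNgt; apply/negP => Mg.
pose u : 'rV[R]_(m + m) := row_mx (const_mx 1) 0.
have cu : continuous_at (0 : R) (fun s : R => p + s *: u).
  apply: continuous_rV => a.
  have -> : (fun s : R => (p + s *: u) 0 a) = (fun s => p 0 a + s * u 0 a).
    by apply/funext => s; rewrite !mxE.
  apply: for_continuousD; first exact: cst_continuous.
  by apply: for_continuousM; [exact: cvg_id|exact: cst_continuous].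
have cgu : continuous_at (0 : R) (fun s : R => g (p + s *: u)).
  by apply: for_continuous_comp; [exact: cu|exact: cg].
have near1 : \forall s \near (0 : R), M < g (p + s *: u).
  by apply: (cvgr_gt _ cgu); rewrite scale0r addr0.
have near2 : \forall s \near 0^'+, forall j, p 0 (lshift m j) + s != 0.
  apply: filter_forall => j; have [x0|x0] := ltP (p 0 (lshift m j)) 0.
    have x0' : 0 < - p 0 (lshift m j) by rewrite oppr_gt0.
    apply: filterS (nbhs_right_lt x0') => s sx.
    by rewrite lt_eqF// addrC -ltrBrDr sub0r.
  apply: filterS (nbhs_right_gt 0) => s s0.
  by rewrite gt_eqF// ltr_wpDl.
have near1' : \forall s \near 0^'+, M < g (p + s *: u) by apply: cvg_within near1.
have [s [s1 s2]] := filter_ex (filterI near1' near2).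
have [j|theta E] := @orbit_surj R m P i (toC (p + s *: u)).
  rewrite mxE eq_complex /= negb_and; apply/orP; left.
  have ul : u 0 (lshift m j) = 1 by rewrite row_mxEl mxE.
  by rewrite [X in X != _]mxE [X in _ + X]mxE ul mulr1; exact: s2.
by have := gM _ _ _ E; rewrite leNgt s1.
Qed.

Lemma sec_norm2_decay : exists kappa A : R, [/\ 0 < kappa, 0 < A &
  forall (k : nat) (a : 'rV[int]_m) (t : R) (i : chart P) (w : 'rV[R[i]]_m),
  (1 <= k)%N -> 0 <= t <= 1 -> lattice_points P k a ->
  sec_norm2 (h t) k a i w / Qnorm (h t) k a <=
  A * (k%:R ^+ 4) ^+ m * expR (- (k%:R * kappa * lattice_dist2 k a t i w))].
Proof.
have [kappa [A [kappa0 A0 H]]] := sec_norm2_orbit_decay.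
exists kappa, A; split=> // k a t i w k1 t01 Pa.
pose g p := sec_norm2 (h t) k a i (toC p) * expR (k%:R * kappa * lattice_dist2 k a t i (toC p))
  / Qnorm (h t) k a.
have gM p : g p <= A * (k%:R ^+ 4) ^+ m.
  apply: (@open_orbit_dense i); last by move=> rho theta q E; exact: H E.
  move=> q; apply: for_continuousM; last exact: cst_continuous.
  apply: for_continuousM; first exact: continuous_sec_norm2.
  apply: (@for_continuous_comp _ _ _ (fun p => k%:R * kappa * lattice_dist2 k a t i (toC p)) expR);
    last exact: continuous_expR.
  apply: for_continuousM; first exact: cst_continuous.
  have -> : (fun p => lattice_dist2 k a t i (toC p)) =
    (fun p => \sum_j (k%:R^-1 * (a 0 j)%:~R - mu t i (toC p) 0 j) ^+ 2).
    apply/funext => p'; rewrite /lattice_dist2 enorm_sqr; apply: eq_bigr => j _.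
    by rewrite !mxE -expr2.
  apply: for_continuous_sum => j _; apply: for_continuousX; apply: for_continuousD.
    exact: cst_continuous.
  apply: for_continuousN.
  apply: (@for_continuous_comp _ _ _ (fun p => mu t i (toC p)) (fun y : 'rV[R]_m => y 0 j)).
    by have [+ _] := mu_moment t01; apply.
  exact: coord_continuous.
rewrite expRN ler_pdivlMr ?expR_gt0// mulrAC.
have -> : w = toC (row_mx (\row_j complex.Re (w 0 j)) (\row_j complex.Im (w 0 j))).
  by apply/rowP => j; rewrite mxE row_mxEl row_mxEr !mxE; case: (w 0 j).
exact: gM.
Qed.

End Pointwise.

(** * Exponential decay against polynomial growth *)

(** A single term of the exponential series, of order n + 1 with D <= delta (n + 1), dominates x^D
    for x >= 1. *)
Lemma powR_expR_bounded (R : realType) (D kappa delta : R) : 0 < kappa -> 0 < delta ->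
  exists K : R, forall x, 1 <= x -> x `^ D * expR (- (kappa * x `^ delta)) <= K.
Proof.
move=> kappa0 delta0; pose n := Num.Def.archi_bound (`|D| / delta).
have Dn : D <= delta * n.+1%:R.
  have : `|D| / delta < n%:R by rewrite archi_boundP// divr_ge0// ltW.
  rewrite ltr_pdivrMr// => H; apply: le_trans (ler_norm _) _.
  by rewrite mulrC (le_trans (ltW H))// ler_wpM2r ?(ltW delta0)// ler_nat.
exists (n.+1`!%:R / kappa ^+ n.+1) => x x1.
have x0 : 0 < x by lra.
have y0 : 0 <= kappa * x `^ delta by rewrite mulr_ge0 ?powR_ge0 ?ltW.
rewrite expRN ler_pdivrMr ?expR_gt0//.
have f0 : 0 < n.+1`!%:R :> R by rewrite ltr0n fact_gt0.
have H : (kappa * x `^ delta) ^+ n.+1 <= expR (kappa * x `^ delta) * n.+1`!%:R.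
  by rewrite -ler_pdivrMr//; apply: le_trans (expR_ge1Dxn n y0); rewrite lerDr.
have k0 : 0 < kappa ^+ n.+1 by rewrite exprn_gt0.
have k0' : kappa ^+ n.+1 != 0 by rewrite gt_eqF.
rewrite -(ler_pM2l k0) mulrA mulrCA mulfV// mulr1 mulrC.
rewrite [leRHS]mulrC; apply: le_trans H; rewrite exprMn mulrC ler_wpM2l ?(ltW k0)//.
by rewrite -powR_mulrn ?powR_ge0// -powRrM; exact: ler_powR.
Qed.

Theorem lemma1p2 (R : realType) (m : nat) (P : delzant R m)
    (h0 h1 : metric P) (h : R -> metric P)
    (h0_toric : toric_metric h0) (h1_toric : toric_metric h1)
    (h_geodesic : mabuchi_geodesic h0 h1 h)
    (mu : R -> chart P -> 'rV[R[i]]_m -> 'rV[R]_m)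
    (mu_moment : forall t, 0 <= t <= 1 -> is_moment_map (h t) (mu t))
    (B : nat -> R -> 'rV[int]_m -> R[i]) (C0 N : R)
    (C0_ge0 : 0 <= C0) (N_ge0 : 0 <= N)
    (B_bound : forall k t a, (1 <= k)%N -> 0 <= t <= 1 ->
       lattice_points P k a -> normc (B k t a) <= C0 * k%:R `^ N) :
  exists2 C : R, 0 < C &
  forall delta : R, 0 < delta ->
  exists K : R, forall (k : nat) (t : R) (i : chart P) (w : 'rV[R[i]]_m),
    (1 <= k)%N -> 0 <= t <= 1 ->
    normc
      (\sum_(a \in lattice_points P k)
          B k t a * (sec_norm2 (h t) k a i w / Qnorm (h t) k a)%:C
       - \sum_(a \in [set a | lattice_points P k a /\
                 enorm (k%:R^-1 *: intrv R a - mu t i w)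
                   <= k%:R `^ (- (1 / 2) + delta)])
          B k t a * (sec_norm2 (h t) k a i w / Qnorm (h t) k a)%:C)
    <= K * k%:R `^ (- C).
Proof.
have hT := geodesic_toric h_geodesic; have hS := geodesic_smooth h_geodesic.
have [kappa [A [kappa0 A0 decay]]] := sec_norm2_decay hT hS mu_moment.
have [V count] := lattice_points_count P.
(* The decay beats every power of k, so C can be fixed before delta; its value only enters K. *)
exists 1 => // delta delta0.
have delta2 : 0 < 2 * delta by rewrite mulr_gt0.
(* N from the bound on B, 4 m from [sec_norm2_decay], m from the number of lattice points, and 1 for
   C. *)
have [K0 K0P] := @powR_expR_bounded R (N + (5 * m)%:R + 1) kappa (2 * delta) kappa0 delta2.
pose L : R := (2 * V + 1)%:R ^+ m.
exists (L * C0 * A * K0) => k t i w k1 t01.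
have k1R : 1 <= k%:R :> R by rewrite ler1n.
have k0 : 0 < k%:R :> R by rewrite ltr0n.
pose E := expR (- (kappa * k%:R `^ (2 * delta))).
pose M := C0 * k%:R `^ N * (A * (k%:R ^+ 4) ^+ m * E).
have M0 : 0 <= M.
  by rewrite /M !mulr_ge0 ?powR_ge0 ?expR_ge0 ?exprn_ge0 ?(ltW A0) ?(ltW k0).
have [s [s_size sP]] := count k.
set F := fun a => B k t a * _.
have FM a : lattice_points P k a ->
    ~ (lattice_points P k a /\
       enorm (k%:R^-1 *: intrv R a - mu t i w) <= k%:R `^ (- (1 / 2) + delta)) ->
    normc (F a) <= M.
  move=> Pa /not_andP[//|/negP]; rewrite -ltNge => far.
  rewrite /F normcM /M.
  have s0 : 0 <= sec_norm2 (h t) k a i w / Qnorm (h t) k a.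
    rewrite divr_ge0 ?(Qnorm_ge0 hT)// mulr_ge0 ?sqr_ge0// exprn_ge0// ltW//.
    exact: (metric_gt0 (hT _ t01)).
  rewrite ler_pM ?normc_ge0 ?B_bound//.
  rewrite /= expr0n addr0 sqrtr_sqr ger0_norm//.
  apply: le_trans (decay k a t i w k1 t01 Pa) _.
  rewrite ler_wpM2l ?mulr_ge0 ?exprn_ge0 ?(ltW A0) ?(ltW k0)//.
  rewrite ler_expR lerN2 [k%:R * kappa]mulrC -mulrA ler_wpM2l ?(ltW kappa0)//.
  (* The scale k^(-1/2) is the one at which k times the squared radius is a pure power k^(2
     delta). *)
  have -> : k%:R `^ (2 * delta) = k%:R * (k%:R `^ (- (1 / 2) + delta)) ^+ 2.
    have -> : 2 * delta = 1 + (- (1 / 2) + delta) * 2%:R by lra.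
    by rewrite powRD ?(gt_eqF k0) ?implybT// powRr1 ?(ltW k0)// powRrM powR_mulrn ?powR_ge0.
  rewrite ler_wpM2l ?(ltW k0)//; apply: lerXn2r; rewrite ?nnegrE ?powR_ge0 ?sqrtr_ge0//.
  exact: ltW.
have := @normc_fsbig_diff_le R _ (lattice_points P k) _ F M _ s s_size sP _ M0 FM.
move=> /(_ (fun a => @proj1 _ _))/le_trans; apply.
have nk : ((2 * (k * V)).+1 ^ m)%:R <= L * k%:R ^+ m :> R.
  rewrite /L -exprMn natrX; apply: lerXn2r; rewrite ?nnegrE ?mulr_ge0//.
  by rewrite -natrM ler_nat -addn1 mulnDl mul1n leq_add// -mulnA [(V * k)%N]mulnC.
apply: le_trans (ler_wpM2r M0 nk) _.
have kD : k%:R `^ (N + (5 * m)%:R + 1) = k%:R `^ N * (k%:R ^+ m * (k%:R ^+ 4) ^+ m) * k%:R.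
  rewrite !powRD ?(gt_eqF k0) ?implybT// powR_mulrn ?(ltW k0)// powRr1 ?(ltW k0)//.
  by rewrite -exprM -exprD mulSn.
have := K0P k%:R k1R; rewrite -/E kD => KE.
have -> : L * k%:R ^+ m * M = L * C0 * A * (k%:R `^ N * (k%:R ^+ m * (k%:R ^+ 4) ^+ m) * E).
  by rewrite /M; ring.
rewrite -[leRHS]mulrA ler_wpM2l ?mulr_ge0 ?exprn_ge0 ?(ltW A0)//.
rewrite powR_inv1 ?(ltW k0)// ler_pdivlMr//; apply: le_trans KE.
by rewrite mulrAC.
Qed.
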